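(* Let $q\in\mathbf C$ with $0<|q|<1$, let $R=\mathrm{Diag}(\rho_1,\rho_2)$, $S=\mathrm{Diag}(\sigma_1,\sigma_2)$ with $\rho_i,\sigma_i\in\mathbf C^*$, and $\underline x=\{x_1,x_2,x_3,x_4\}\subset\mathbf C^*$, subject to (FR), (NR), (NS) of the context. Let $M\in F_{R,S,\underline x}$ admit a Mano decomposition. Then $M$ admits a Mano decomposition whose factor $C$ is in one of the following forms, and only one of these three types of form is possible for $M$: $$C=\begin{pmatrix}\xi&0\\0&\xi\end{pmatrix}\ \text{(trivial)},\qquad C=\begin{pmatrix}\xi_1&0\\0&\xi_2\end{pmatrix},\ \xi_1\ne\xi_2\ \text{(generic)},\qquad C=\begin{pmatrix}\xi&\xi\\0&\xi\end{pmatrix}\ \text{(logarithmic)},$$ with $\xi_1,\xi_2$, resp. $\xi$, in the annulus $\{z\in\mathbf C:|q|<|z|\le1\}$. Moreover this form of $C$ is unique, except that in the generic form $\xi_1$ and $\xi_2$ can be permuted.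
   Context: Notation: $\sigma_qf(x):=f(qx)$ (entrywise on matrices); $a\equiv b$ means $a/b\in q^{\mathbf Z}$; $\mathcal O(\mathbf C^* )$ is the ring of holomorphic functions on $\mathbf C^*$. Conditions: (FR) $x_1x_2x_3x_4\equiv\rho_1\rho_2/(\sigma_1\sigma_2)$. (NR) $\rho_1/\rho_2,\ \sigma_1/\sigma_2\notin q^{\mathbf Z}$ and $x_k/x_l\notin q^{\mathbf Z}$ for $1\le k<l\le4$. (NS) $\rho_i/\sigma_j\not\equiv x_1x_2$ for all $i,j\in\{1,2\}$. $F_{R,S,\underline x}$ is the set of $M\in\mathrm{Mat}_2(\mathcal O(\mathbf C^* ))$ with $\sigma_qM=RM(Sx^2)^{-1}$, $\det M$ not identically zero, and $\det M$ vanishing at $x_1,x_2,x_3,x_4$. A Mano decomposition $M=PQ$ with factor $C\in\mathrm{GL}_2(\mathbf C)$ is given by $P,Q\in\mathrm{Mat}_2(\mathcal O(\mathbf C^* ))$ such that $M=PQ$, $\sigma_qP=RP(Cx)^{-1}$ and $\det P$ vanishes at $x_1$ and $x_2$. The factors of the various Mano decompositions of a given $M$ are exactly the matrices $(\sigma_q\Lambda)C\Lambda^{-1}$ that lie in $\mathrm{GL}_2(\mathbf C)$, with $\Lambda\in\mathrm{GL}_2(\mathcal O(\mathbf C^* ))$ and $C$ the factor of one of them. *)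

(* Defs.v *)
From HB Require Import structures.
From mathcomp Require Import all_boot all_order all_algebra.
From mathcomp Require Import complex.
From mathcomp Require Import all_classical all_reals all_analysis.

Set Implicit Arguments.
Unset Strict Implicit.
Unset Printing Implicit Defensive.

Import Order.TTheory GRing.Theory Num.Theory.
Import numFieldNormedType.Exports.

Local Open Scope ring_scope.
Local Open Scope complex_scope.

(* Functions on C^* are represented by total functions on C = R[i]; their value
   at 0 is irrelevant, all conditions being imposed away from 0 only. *)

(* Over the scalar field R[i], [derivable f z 1] is the existence of the limit
   of (f (z + h) - f z) / h as the complex number h <> 0 tends to 0. *)
Definition holomorphic_Cstar (R : realType) (f : R[i] -> R[i]) : Prop :=
  forall z : R[i], z != 0 -> derivable (f : R[i]^o -> R[i]^o) z 1.

Definition holomorphic_mx (R : realType) (M : R[i] -> 'M[R[i]]_2) : Prop :=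
  forall i j : 'I_2, holomorphic_Cstar (fun z => M z i j).

Definition q_equiv (R : realType) (q a b : R[i]) : Prop :=
  exists n : int, a / b = q ^ n.

Definition diag_fun (R : realType) (d : 'I_2 -> R[i]) : 'M[R[i]]_2 :=
  diag_mx (\row_i d i).

(* The points x_1, x_2, x_3, x_4 are x 0, x 1, x 2, x 3. *)
Definition cond_FR (R : realType) (q : R[i]) (rho sigma : 'I_2 -> R[i])
    (x : 'I_4 -> R[i]) : Prop :=
  q_equiv q (\prod_k x k) (rho 0 * rho 1 / (sigma 0 * sigma 1)).

Definition cond_NR (R : realType) (q : R[i]) (rho sigma : 'I_2 -> R[i])
    (x : 'I_4 -> R[i]) : Prop :=
  [/\ ~ q_equiv q (rho 0) (rho 1),
      ~ q_equiv q (sigma 0) (sigma 1) &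
      forall k l : 'I_4, (k < l)%N -> ~ q_equiv q (x k) (x l)].

Definition cond_NS (R : realType) (q : R[i]) (rho sigma : 'I_2 -> R[i])
    (x : 'I_4 -> R[i]) : Prop :=
  forall i j : 'I_2, ~ q_equiv q (rho i / sigma j) (x 0 * x 1).

(* The set F_{A, B, x}: sigma_q M = A M (B z^2)^-1; the letter R is taken by the
   real field. *)
Definition in_F (R : realType) (q : R[i]) (A B : 'M[R[i]]_2)
    (x : 'I_4 -> R[i]) (M : R[i] -> 'M[R[i]]_2) : Prop :=
  [/\ holomorphic_mx M,
      forall z, z != 0 -> M (q * z) = A *m M z *m invmx (z ^+ 2 *: B),
      exists2 z, z != 0 & \det (M z) != 0 &
      forall k, \det (M (x k)) = 0].

Definition mano_decomposition (R : realType) (q : R[i]) (A : 'M[R[i]]_2)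
    (x : 'I_4 -> R[i]) (M : R[i] -> 'M[R[i]]_2) (C : 'M[R[i]]_2)
    (P Q : R[i] -> 'M[R[i]]_2) : Prop :=
  [/\ holomorphic_mx P /\ holomorphic_mx Q,
      C \in unitmx,
      forall z, z != 0 -> M z = P z *m Q z,
      forall z, z != 0 -> P (q * z) = A *m P z *m invmx (z *: C) &
      \det (P (x 0)) = 0 /\ \det (P (x 1)) = 0].

Definition mano_factor (R : realType) (q : R[i]) (A : 'M[R[i]]_2)
    (x : 'I_4 -> R[i]) (M : R[i] -> 'M[R[i]]_2) (C : 'M[R[i]]_2) : Prop :=
  exists P Q : R[i] -> 'M[R[i]]_2, mano_decomposition q A x M C P Q.

Definition in_annulus (R : realType) (q z : R[i]) : Prop :=
  `|q| < `|z| <= 1.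

Definition mx2 (R : realType) (a b c d : R[i]) : 'M[R[i]]_2 :=
  \matrix_(i, j) if i == 0 then (if j == 0 then a else b)
                 else (if j == 0 then c else d).

Inductive factor_type : Set := Trivial | Generic | Logarithmic.

Definition normal_form (R : realType) (q : R[i]) (t : factor_type)
    (C : 'M[R[i]]_2) : Prop :=
  match t with
  | Trivial => exists xi, in_annulus q xi /\ C = mx2 xi 0 0 xi
  | Generic => exists xi1 xi2,
      [/\ in_annulus q xi1, in_annulus q xi2, xi1 != xi2 &
          C = mx2 xi1 0 0 xi2]
  | Logarithmic => exists xi, in_annulus q xi /\ C = mx2 xi xi 0 xi
  end.

(* Main.v *)
Require Import Defs.
From HB Require Import structures.
From mathcomp Require Import all_boot all_order all_algebra.
From mathcomp Require Import complex.
From mathcomp Require Import all_classical all_reals all_analysis.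
From mathcomp Require Import ring lra zify.

Import Order.TTheory GRing.Theory Num.Theory.
Import numFieldNormedType.Exports.

Local Open Scope ring_scope.
Local Open Scope complex_scope.

Set Implicit Arguments.
Unset Strict Implicit.
Unset Printing Implicit Defensive.

(** Two factors C, C' of M are linked by L = P'^-1 P = Q' Q^-1, for which
    L(qz) C = C' L(z).  Up to constants, det P' and det Q satisfy
    f(qz) = c z^-2 f(z), and such a function, if not zero, has at most two zeros
    modulo powers of q; so det P' vanishes only at the classes of x_1, x_2 and
    det Q only at those of x_3, x_4, and L is holomorphic on C^*.  When C and C'
    are triangular with eigenvalues in the annulus, the functional equation kills
    all Laurent coefficients of L but the constant one: L is a constant matrix,
    and C and C' are similar.  Existence is a Jordan reduction of C followed by
    gauge transformations by diagonal matrices of powers of z.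

    Laurent coefficients are circle means.  They do not depend on the circle by
    Goursat's theorem, applied to f(exp w) on parallelograms one side of which is
    the period 2 i pi; they determine f by Fejer's theorem; and they show that the
    solutions of f(qz) = c z^-2 f(z) form a space of dimension at most 2.  The
    bound on zeros follows by comparison with the products of two theta
    functions. *)

(** * Modulus and continuity *)

(** The usual tools for counting zeros, isolated zeros and the argument principle, are avoided. A
    solution of f(qz) = c z^-2 f(z) is compared with two theta products inside a space of dimension
    at most 2, and zeros are told apart only modulo powers of q; this is enough because x_1, ...,
    x_4 are pairwise inequivalent. The same bound replaces the identity theorem: a nonzero solution
    cannot vanish on a ball, so an identity proved where det P or det P' is nonzero extends to C^*
    by continuity. This serves twice, for the equation of det Q and for that of L, both of which are
    first obtained by inverting or cancelling P or P'.

    The theta products are not shown to be holomorphic. They enter only through their circle means,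
    and independence of the circle survives limits that are uniform on circles.

    The annulus matters because two of its elements with quotient in q^Z are equal: an equation c
    a_n = q^n d a_n between Laurent coefficients then forces a_n = 0 for every n other than 0. *)

Section ComplexModulus.
Variable R : realType.
Implicit Types (z w : R[i]) (e : R).

(** The norm on [R[i]] takes its values in [R[i]]; a real-valued modulus lets the estimates be
    closed by [lra] and [nra]. *)
Definition cabs z : R := complex.Re `|z|.

Lemma cabsE z : `|z| = (cabs z)%:C.
Proof. by []. Qed.

Lemma cabs_ge0 z : 0 <= cabs z.
Proof. by rewrite -lecR -cabsE normr_ge0. Qed.

Lemma cabsM z w : cabs (z * w) = cabs z * cabs w.
Proof. by apply: complexI; rewrite rmorphM /= -!cabsE normrM. Qed.

Lemma cabsD z w : cabs (z + w) <= cabs z + cabs w.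
Proof. by rewrite -lecR rmorphD /= -!cabsE ler_normD. Qed.

Lemma cabsN z : cabs (- z) = cabs z.
Proof. by rewrite /cabs normrN. Qed.

Lemma cabsC z w : cabs (z - w) = cabs (w - z).
Proof. by rewrite -cabsN opprB. Qed.

Lemma cabs_trans w z u : cabs (z - u) <= cabs (z - w) + cabs (w - u).
Proof. by have := cabsD (z - w) (w - u); rewrite addrA subrK. Qed.

Lemma cabsB z w : cabs z - cabs w <= cabs (z - w).
Proof. by have := cabsD (z - w) w; rewrite subrK; lra. Qed.

Lemma cabs_eq0 z : (cabs z == 0) = (z == 0).
Proof. by rewrite -(inj_eq (@complexI R)) -cabsE normr_eq0. Qed.

Lemma cabs0 : cabs 0 = 0 :> R.
Proof. by apply/eqP; rewrite cabs_eq0. Qed.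

Lemma cabs_gt0 z : (0 < cabs z) = (z != 0).
Proof. by rewrite lt_neqAle cabs_ge0 andbT eq_sym cabs_eq0. Qed.

Lemma cabs1 : cabs 1 = 1 :> R.
Proof. by rewrite /cabs normr1. Qed.

Lemma cabsV z : cabs z^-1 = (cabs z)^-1.
Proof. by apply: complexI; rewrite fmorphV /= -!cabsE normfV. Qed.

Lemma cabsX z n : cabs (z ^+ n) = cabs z ^+ n.
Proof. by apply: complexI; rewrite rmorphXn /= -!cabsE normrX. Qed.

Lemma cabsXz z (n : int) : cabs (z ^ n) = cabs z ^ n.
Proof. by case: n => n; rewrite ?NegzE /= ?cabsV -?exprnN ?cabsX // cabsV cabsX. Qed.

Lemma cabsR (a : R) : cabs a%:C = `|a|.
Proof.
by apply: complexI; rewrite -cabsE normc_def /= expr0n /= addr0 sqrtr_sqr.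
Qed.

Lemma cabs_nat n : cabs n%:R = n%:R :> R.
Proof. by rewrite -(rmorph_nat (real_complex R)) cabsR ger0_norm. Qed.

Lemma ltr_cabs z w : (`|z| < `|w|) = (cabs z < cabs w).
Proof. by rewrite !cabsE ltcR. Qed.

Lemma ler_cabs z w : (`|z| <= `|w|) = (cabs z <= cabs w).
Proof. by rewrite !cabsE lecR. Qed.

Lemma Re_le_cabs z : `|complex.Re z| <= cabs z.
Proof. by rewrite -lecR -cabsE normc_ge_Re. Qed.

Lemma cabs_le_ReIm z : cabs z <= `|complex.Re z| + `|complex.Im z|.
Proof.
case: z => a b /=; rewrite -[a +i* b]/(Complex a b) (_ : a +i* b = a%:C + 'i * b%:C).
  apply: le_trans (cabsD _ _) _; rewrite cabsM !cabsR.
  by rewrite /cabs normc_def /= expr0n add0r expr1n sqrtr1 mul1r.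
by rewrite [LHS]complexE.
Qed.

Lemma Im_le_cabs z : `|complex.Im z| <= cabs z.
Proof.
have := Re_le_cabs (z * 'i); rewrite ReiNIm normrN cabsM.
by rewrite {2}/cabs normc_def /= expr0n add0r expr1n sqrtr1 mulr1.
Qed.

Lemma cabs_small z : (forall e, 0 < e -> cabs z <= e) -> z = 0.
Proof.
move=> h; apply/eqP; rewrite -cabs_eq0; apply/eqP/le_anti.
by rewrite cabs_ge0 andbT; apply/ler_addgt0Pl => e /h; rewrite addr0.
Qed.

End ComplexModulus.

Section MetricContinuity.
Variable R : realType.

Definition cdist (z w : R[i]) : R := cabs (z - w).
Definition rdist (s t : R) : R := `|s - t|.

(** The distance is a parameter so that the same rules serve functions on the plane ([cdist]) and
    paths with a real parameter ([rdist]). *)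
Definition dcont (T : Type) (d : T -> T -> R) (f : T -> R[i]) (x : T) :=
  forall e : R, 0 < e ->
    exists2 r : R, 0 < r & forall y, d y x < r -> cabs (f y - f x) < e.

Lemma dcont_eq T (d : T -> T -> R) f g x :
  f =1 g -> dcont d f x -> dcont d g x.
Proof. by move=> fg h e /h[r r0 hr]; exists r => // y; rewrite -!fg; exact: hr. Qed.

Lemma dcont_cst T (d : T -> T -> R) c x : dcont d (fun=> c) x.
Proof. by move=> e e0; exists 1 => // y _; rewrite subrr cabs0. Qed.

Lemma dcont_id z : dcont cdist id z.
Proof. by move=> e e0; exists e. Qed.

Lemma dcontD T (d : T -> T -> R) f g x :
  dcont d f x -> dcont d g x -> dcont d (fun y => f y + g y) x.
Proof.
move=> hf hg e e0; have [e2 _] : 0 < e / 2 /\ True by split => //; lra.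
have [r r0 hr] := hf _ e2; have [s s0 hs] := hg _ e2.
exists (Num.min r s); first by rewrite lt_min r0.
move=> y; rewrite lt_min => /andP[/hr yr /hs ys].
have -> : f y + g y - (f x + g x) = (f y - f x) + (g y - g x) by ring.
by apply: le_lt_trans (cabsD _ _) _; lra.
Qed.

Lemma dcontM T (d : T -> T -> R) f g x :
  dcont d f x -> dcont d g x -> dcont d (fun y => f y * g y) x.
Proof.
move=> hf hg e e0.
set F := cabs (f x); set G := cabs (g x).
have F0 : 0 <= F := cabs_ge0 _; have G0 : 0 <= G := cabs_ge0 _.
have k0 : 0 < 2 + F + G by lra.
(* If both factors err by less than [dl <= 1], the product errs by at most [dl * (1 + F + G)], which
   is below [e]. *)
set dl := Num.min 1 (e / (2 + F + G)).
have dl0 : 0 < dl by rewrite lt_min ltr01 divr_gt0.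
have dl1 : dl <= 1 by rewrite ge_min lexx.
have dle : dl * (2 + F + G) <= e by rewrite -ler_pdivlMr // ge_min lexx orbT.
have [r r0 hr] := hf _ dl0; have [s s0 hs] := hg _ dl0.
exists (Num.min r s); first by rewrite lt_min r0.
move=> y; rewrite lt_min => /andP[/hr yr /hs ys].
have -> : f y * g y - f x * g x =
  (f y - f x) * (g y - g x) + (f x * (g y - g x) + (f y - f x) * g x) by ring.
apply: le_lt_trans (cabsD _ _) _.
have h1 := cabsD (f x * (g y - g x)) ((f y - f x) * g x).
rewrite !cabsM -/F -/G in h1 *.
have A0 := cabs_ge0 (f y - f x); have B0 := cabs_ge0 (g y - g x).
nra.
Qed.

Lemma dcontN T (d : T -> T -> R) f x : dcont d f x -> dcont d (fun y => - f y) x.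
Proof.
move=> hf; apply: (@dcont_eq _ _ (fun y => -1 * f y)); last first.
  by apply: dcontM => //; exact: dcont_cst.
by move=> y; rewrite mulN1r.
Qed.

Lemma dcontB T (d : T -> T -> R) f g x :
  dcont d f x -> dcont d g x -> dcont d (fun y => f y - g y) x.
Proof. by move=> hf hg; apply: dcontD => //; exact: dcontN. Qed.

Lemma dcont_neq0 T (d : T -> T -> R) f x : dcont d f x -> f x != 0 ->
  exists2 r : R, 0 < r & forall y, d y x < r -> f y != 0.
Proof.
move=> hf fx; have [r r0 hr] := hf (cabs (f x)) (etrans (cabs_gt0 _) fx).
by exists r => // y /hr; apply: contraTneq => ->; rewrite sub0r cabsN ltxx.
Qed.

Lemma dcontV T (d : T -> T -> R) f x : f x != 0 ->
  dcont d f x -> dcont d (fun y => (f y)^-1) x.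
Proof.
move=> fx hf e e0; set F := cabs (f x).
have F0 : 0 < F by rewrite cabs_gt0.
(* The first bound keeps [cabs (f y)] above [F / 2], so the denominator of the difference of
   inverses exceeds [F ^+ 2 / 2]; the second bound is [e] times that. *)
set dl := Num.min (F / 2) (e * F ^+ 2 / 2).
have dl0 : 0 < dl by rewrite lt_min !divr_gt0 ?mulr_gt0 ?exprn_gt0.
have [r r0 hr] := hf _ dl0; exists r => // y /hr; rewrite lt_min => /andP[h1 h2].
have h3 : F / 2 < cabs (f y).
  by have := cabsB (f x) (f y); rewrite cabsC -/F; lra.
have fy : f y != 0 by rewrite -cabs_gt0; lra.
have -> : (f y)^-1 - (f x)^-1 = (f x - f y) / (f y * f x).
  by field; rewrite fx fy.
rewrite cabsM cabsV cabsM cabsC ltr_pdivrMr; last by rewrite mulr_gt0 // cabs_gt0.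
apply: lt_trans h2 _; rewrite -/F.
have : 0 < e * F by rewrite mulr_gt0.
nra.
Qed.

Lemma dcont_comp T (d : T -> T -> R) (f : T -> R[i]) (g : R[i] -> R[i]) x :
  dcont d f x -> dcont cdist g (f x) -> dcont d (fun y => g (f y)) x.
Proof. by move=> hf hg e /hg[r /hf[s s0 hs] hr]; exists s => // y /hs; exact: hr. Qed.

Lemma dcontX T (d : T -> T -> R) f n x :
  dcont d f x -> dcont d (fun y => f y ^+ n) x.
Proof.
move=> hf; elim: n => [|n IHn]; first exact: dcont_cst.
apply: (@dcont_eq _ _ (fun y => f y * f y ^+ n)); first by move=> y; rewrite exprS.
exact: dcontM.
Qed.

Lemma dcontXz T (d : T -> T -> R) f (n : int) x : f x != 0 ->
  dcont d f x -> dcont d (fun y => f y ^ n) x.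
Proof.
case: n => n fx hf; first exact: dcontX.
apply: (@dcont_eq _ _ (fun y => (f y ^+ n.+1)^-1)); first by [].
by apply: dcontV; [exact: expf_neq0|exact: dcontX].
Qed.

Lemma dcont_real (a b : R[i]) (t : R) :
  dcont rdist (fun s : R => a + s%:C * b) t.
Proof.
move=> e e0; have B0 := cabs_ge0 b; have k0 : 0 < 1 + cabs b by lra.
exists (e / (1 + cabs b)); first by rewrite divr_gt0.
move=> s; rewrite /rdist ltr_pdivlMr // => hs.
have -> : a + s%:C * b - (a + t%:C * b) = (s - t)%:C * b.
  by rewrite rmorphB /=; ring.
rewrite cabsM cabsR; apply: le_lt_trans hs; rewrite ler_wpM2l //; lra.
Qed.

End MetricContinuity.

(** * Complex derivatives and sequences *)

Section ComplexDerivative.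
Variable R : realType.
Implicit Types (f g : R[i] -> R[i]) (z : R[i]).

(* Caratheodory's form of differentiability: products, quotients and
   compositions become identities between the slope functions. *)
Definition cdiff f z := exists2 phi : R[i] -> R[i],
  dcont (@cdist R) phi z & forall w, f w = f z + phi w * (w - z).

Lemma cdiff_cont f z : cdiff f z -> dcont (@cdist R) f z.
Proof.
move=> [phi hphi hf]; apply: (@dcont_eq _ _ _ (fun w => f z + phi w * (w - z))) => //.
apply: dcontD; first exact: dcont_cst.
by apply: dcontM => //; apply: dcontB; [exact: dcont_id|exact: dcont_cst].
Qed.

Lemma cdiff_eq f g z : f =1 g -> cdiff f z -> cdiff g z.
Proof. by move=> fg [phi hphi hf]; exists phi => // w; rewrite -!fg. Qed.

Lemma cdiffP f z : cdiff f z <-> exists l, forall e : R, 0 < e ->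
  exists2 r : R, 0 < r & forall w, cabs (w - z) < r ->
    cabs (f w - f z - l * (w - z)) <= e * cabs (w - z).
Proof.
split=> [[phi hphi hf]|[l hl]].
  exists (phi z) => e /hphi[r r0 hr]; exists r => // w /hr wr.
  rewrite hf [f z + _]addrC addrK -mulrBl cabsM ler_wpM2r ?cabs_ge0 //; lra.
exists (fun w => if w == z then l else (f w - f z) / (w - z)); last first.
  move=> w; case: eqVneq => [->|wz]; first by rewrite subrr mulr0 addr0.
  by rewrite mulfVK ?subr_eq0 // addrC subrK.
move=> e e0; have [r r0 hr] := hl (e / 2) ltac:(lra).
exists r => // w wr; rewrite /= eqxx; case: (eqVneq w z) => [_|wz].
  by rewrite subrr cabs0.
have h0 : 0 < cabs (w - z) by rewrite cabs_gt0 subr_eq0.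
have h1 : w - z != 0 by rewrite subr_eq0.
rewrite -(ltr_pM2r h0) -cabsM mulrBl mulfVK //.
apply: le_lt_trans (hr _ wr) _; rewrite ltr_pM2r //; lra.
Qed.

Lemma derivableE f z : derivable (f : R[i]^o -> R[i]^o) z 1 <-> cdiff f z.
Proof.
split=> [/cvg_ex[/= l /cvgrPdist_lt hl]|].
  exists (fun w => if w == z then l else (f w - f z) / (w - z)); last first.
    move=> w; case: eqVneq => [->|wz]; first by rewrite subrr mulr0 addr0.
    by rewrite mulfVK ?subr_eq0 // addrC subrK.
  move=> e e0; have /hl : 0 < e%:C by rewrite ltcR.
  move=> /nbhs_ballP[r /= r0 hr].
  have rE : r = (complex.Re r)%:C by rewrite RRe_real // gtr0_real.
  exists (complex.Re r); first by rewrite -ltcR -rE.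
  move=> w wr; rewrite /= eqxx; case: (eqVneq w z) => [_|wz].
    by rewrite subrr cabs0.
  have := hr (w - z); rewrite /ball /= sub0r normrN rE cabsE ltcR => /(_ wr).
  rewrite subr_eq0 => /(_ wz); rewrite /shift /= /= [_ *: 1]mulr1 subrK.
  by rewrite cabsE ltcR cabsC [_ *: _]mulrC.
move=> /cdiffP[l hl]; apply/cvg_ex; exists l; apply/cvgrPdist_lt => /= eps eps0.
have epsE : eps = (complex.Re eps)%:C by rewrite RRe_real // gtr0_real.
have e0 : 0 < complex.Re eps by rewrite -ltcR -epsE.
have [r r0 hr] := hl (complex.Re eps / 2) ltac:(lra).
apply/nbhs_ballP; exists r%:C => /=; first by rewrite ltcR.
move=> h; rewrite /ball /= sub0r normrN cabsE ltcR => hr1 h0.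
have := hr (h + z); rewrite addrK => /(_ hr1) h2.
rewrite epsE cabsE ltcR /shift /= [_ *: 1]mulr1.
have c0 : 0 < cabs h by rewrite cabs_gt0.
rewrite -(ltr_pM2r c0) -cabsM mulrBl [_ *: _]mulrC mulfVK // -cabsN opprB.
apply: le_lt_trans h2 _; rewrite ltr_pM2r //; lra.
Qed.

Lemma holomorphicE f : holomorphic_Cstar f <-> forall z, z != 0 -> cdiff f z.
Proof. by split=> h z /h /derivableE. Qed.

Lemma cdiff_cst c z : cdiff (fun=> c) z.
Proof. by exists (fun=> 0); [exact: dcont_cst|move=> w; rewrite mul0r addr0]. Qed.

Lemma cdiff_id z : cdiff id z.
Proof. by exists (fun=> 1); [exact: dcont_cst|move=> w; rewrite mul1r addrC subrK]. Qed.

Lemma cdiffD f g z : cdiff f z -> cdiff g z -> cdiff (fun w => f w + g w) z.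
Proof.
move=> [phi hphi hf] [psi hpsi hg]; exists (fun w => phi w + psi w); first exact: dcontD.
by move=> w; rewrite hf hg; ring.
Qed.

Lemma cdiffM f g z : cdiff f z -> cdiff g z -> cdiff (fun w => f w * g w) z.
Proof.
move=> hf0 hg0; have gc := cdiff_cont hg0.
move: hf0 hg0 => [phi hphi hf] [psi hpsi hg].
exists (fun w => phi w * g w + f z * psi w); last by move=> w; rewrite hf hg; ring.
by apply: dcontD; apply: dcontM => //; exact: dcont_cst.
Qed.

Lemma cdiffN f z : cdiff f z -> cdiff (fun w => - f w) z.
Proof.
move=> hf; apply: (@cdiff_eq (fun w => -1 * f w)); first by move=> w; rewrite mulN1r.
by apply: cdiffM => //; exact: cdiff_cst.
Qed.

Lemma cdiffB f g z : cdiff f z -> cdiff g z -> cdiff (fun w => f w - g w) z.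
Proof. by move=> hf hg; apply: cdiffD => //; exact: cdiffN. Qed.

Lemma cdiff_comp f g z : cdiff f z -> cdiff g (f z) -> cdiff (fun w => g (f w)) z.
Proof.
move=> hf0 [psi hpsi hg]; have fc := cdiff_cont hf0.
move: hf0 => [phi hphi hf].
exists (fun w => psi (f w) * phi w).
  by apply: dcontM => //; exact: dcont_comp.
by move=> w; rewrite hg -mulrA; congr (_ + _ * _); rewrite (hf w) [f z + _]addrC addrK.
Qed.

Lemma cdiff_inv z : z != 0 -> cdiff (fun w => w^-1) z.
Proof.
move=> z0; apply/cdiffP; exists (- z ^- 2) => e e0.
have hc : dcont (@cdist R) (fun w => w^-1) z.
  by apply: dcontV => //; exact: dcont_id.
have Z0 : 0 < cabs z by rewrite cabs_gt0.
have [r r0 hr] := hc (e * cabs z) ltac:(by rewrite mulr_gt0).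
have [s s0 hs] := dcont_neq0 (@dcont_id R z) z0.
exists (Num.min r s); first by rewrite lt_min r0.
move=> w; rewrite lt_min => /andP[/hr h1 /hs w0].
have -> : w^-1 - z^-1 - - z ^- 2 * (w - z) = (w^-1 - z^-1) * (- z^-1) * (w - z).
  by field; rewrite z0 w0.
rewrite 2!cabsM cabsN cabsV ler_wpM2r ?cabs_ge0 // ler_pdivrMr //; exact: ltW.
Qed.

Lemma cdiffV f z : f z != 0 -> cdiff f z -> cdiff (fun w => (f w)^-1) z.
Proof. by move=> fz hf; apply: (@cdiff_comp f (fun w => w^-1)) => //; exact: cdiff_inv. Qed.

Lemma cdiffX n z : cdiff (fun w => w ^+ n) z.
Proof.
elim: n => [|n IHn]; first exact: cdiff_cst.
apply: (@cdiff_eq (fun w => w * w ^+ n)); first by move=> w; rewrite exprS.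
by apply: cdiffM => //; exact: cdiff_id.
Qed.

Lemma cdiffXz (n : int) z : z != 0 -> cdiff (fun w => w ^ n) z.
Proof.
case: n => n z0; first exact: cdiffX.
apply: (@cdiff_eq (fun w => (w ^+ n.+1)^-1)); first by [].
by apply: cdiffV; [exact: expf_neq0|exact: cdiffX].
Qed.

(** The identity in [cdiff] ranges over all [w], which hides that the notion is local; the epsilon
    form shows it. *)
Lemma cdiff_near f g z (r : R) : 0 < r ->
  (forall w, cabs (w - z) < r -> f w = g w) -> cdiff f z -> cdiff g z.
Proof.
move=> r0 fg /cdiffP[l hl]; apply/cdiffP; exists l => e /hl[s s0 hs].
exists (Num.min r s); first by rewrite lt_min r0.
move=> w; rewrite lt_min => /andP[h1 h2].
by rewrite -!fg ?subrr ?cabs0 //; exact: hs.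
Qed.

Lemma cdiff_prod n (F : nat -> R[i] -> R[i]) z : (forall k, cdiff (F k) z) ->
  cdiff (fun w => \prod_(k < n) F k w) z.
Proof.
move=> hF; elim: n => [|n IHn].
  by apply: cdiff_eq (cdiff_cst 1 z) => w; rewrite big_ord0.
apply: (@cdiff_eq (fun w => (\prod_(k < n) F k w) * F n w)).
  by move=> w; rewrite big_ord_recr.
exact: cdiffM.
Qed.

End ComplexDerivative.

Section ComplexSequences.
Variable R : realType.
Implicit Types (u v : nat -> R[i]) (l : R[i]).

Definition clim u l := forall e : R, 0 < e ->
  exists N, forall n, (N <= n)%N -> cabs (u n - l) < e.

Lemma clim_unique u l l' : clim u l -> clim u l' -> l = l'.
Proof.
move=> h h'; apply/eqP; rewrite -subr_eq0; apply/eqP/cabs_small => e e0.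
have [N hN] := h (e / 2) ltac:(lra); have [N' hN'] := h' (e / 2) ltac:(lra).
have := hN (maxn N N') (leq_maxl _ _); have := hN' (maxn N N') (leq_maxr _ _).
by have := cabs_trans (u (maxn N N')) l l'; rewrite (cabsC l (u _)); lra.
Qed.

Lemma clim_eq u v l : u =1 v -> clim u l -> clim v l.
Proof. by move=> uv h e /h[N hN]; exists N => n; rewrite -uv; exact: hN. Qed.

Lemma clim_cst l : clim (fun=> l) l.
Proof. by move=> e e0; exists 0%N => n _; rewrite subrr cabs0. Qed.

Lemma climD u v l l' : clim u l -> clim v l' -> clim (fun n => u n + v n) (l + l').
Proof.
move=> h h' e e0.
have [N hN] := h (e / 2) ltac:(lra); have [N' hN'] := h' (e / 2) ltac:(lra).
exists (maxn N N') => n; rewrite geq_max => /andP[/hN h1 /hN' h2].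
have := cabsD (u n - l) (v n - l'); rewrite addrACA -opprD; lra.
Qed.

Lemma climZ c u l : clim u l -> clim (fun n => c * u n) (c * l).
Proof.
move=> h e e0; have c0 := cabs_ge0 c.
have [N hN] := h (e / (1 + cabs c)) ltac:(apply: divr_gt0; lra).
exists N => n /hN; rewrite ltr_pdivlMr; last by lra.
rewrite -mulrBr cabsM; apply: le_lt_trans.
by have := cabs_ge0 (u n - l); nra.
Qed.

Lemma clim_shift u l : clim u l -> clim (fun n => u n.+1) l.
Proof. by move=> h e /h[N hN]; exists N => n Nn; apply: hN; rewrite ltnW. Qed.

Lemma clim_cauchy u :
  (forall e : R, 0 < e -> exists N, forall m n, (N <= m)%N -> (N <= n)%N ->
     cabs (u m - u n) < e) -> exists l, clim u l.
Proof.
move=> hu.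
have cv (p : R[i] -> R) : (forall z w, `|p z - p w| <= cabs (z - w)) ->
    exists a : R, forall e, 0 < e -> exists N, forall n, (N <= n)%N -> `|p (u n) - a| < e.
  move=> hp; have /cauchy_cvgP/cvg_ex[a /cvgrPdist_lt ha] :
      cauchy ((fun n => p (u n) : R^o) @ \oo)%classic.
    apply/cauchy_ballP => e e0; have [N hN] := hu _ e0.
    exists ((fun n => p (u n)) @` [set n | (N <= n)%N]%classic,
            (fun n => p (u n)) @` [set n | (N <= n)%N]%classic)%classic.
      by split; exists N => // n Nn; exists n.
    move=> [a b] /= [[m Nm <-] [n Nn <-]]; rewrite /ball /=.
    exact: le_lt_trans (hp _ _) (hN _ _ Nm Nn).
  exists a => e /ha[N _ hN]; exists N => n Nn; rewrite distrC; exact: hN.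
have [a ha] : exists a : R, forall e, 0 < e -> exists N, forall n, (N <= n)%N ->
    `|complex.Re (u n) - a| < e.
  by apply: cv => z w; have := Re_le_cabs (z - w); case: z w => [? ?] [? ?].
have [b hb] : exists b : R, forall e, 0 < e -> exists N, forall n, (N <= n)%N ->
    `|complex.Im (u n) - b| < e.
  by apply: cv => z w; have := Im_le_cabs (z - w); case: z w => [? ?] [? ?].
exists (a +i* b) => e e0.
have [N hN] := ha (e / 2) ltac:(lra); have [N' hN'] := hb (e / 2) ltac:(lra).
exists (maxn N N') => n; rewrite geq_max => /andP[/hN h1 /hN' h2].
have := cabs_le_ReIm (u n - (a +i* b)).
case: (u n) h1 h2 => x y /=; lra.
Qed.

Lemma cabs_clim u l (K : R) : clim u l -> (forall n, cabs (u n) <= K) -> cabs l <= K.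
Proof.
move=> h hK; apply/ler_addgt0Pl => e /h[N /(_ N (leqnn _)) hN].
by have := cabsB l (u N); rewrite cabsC; have := hK N; lra.
Qed.

Lemma geom_lt (K e r : R) : 0 <= r < 1 -> 0 < e ->
  exists N, forall n, (N <= n)%N -> K * r ^+ n < e.
Proof.
move=> /andP[r0 r1] e0; have K0 := normr_ge0 K.
have /cvg_expr/cvgrPdist_lt : `|r| < 1 by rewrite ger0_norm.
move=> /(_ (e / (1 + `|K|)))[|N _ hN]; first by apply: divr_gt0 => //; lra.
exists N => n /hN; rewrite sub0r normrN ger0_norm ?exprn_ge0 //.
rewrite ltr_pdivlMr; last by lra.
apply: le_lt_trans; have := ler_norm K; have : 0 <= r ^+ n by rewrite exprn_ge0.
nra.
Qed.

(** Telescoping against a geometric series. The explicit tail is kept because it gives the rate for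
    the infinite products below and locates the limit of the nested parallelograms in Goursat's
    theorem. *)
Lemma clim_geom u (K r : R) : 0 <= r < 1 -> (forall n, cabs (u n.+1 - u n) <= K * r ^+ n) ->
  exists2 l, clim u l & forall n, cabs (u n - l) <= K / (1 - r) * r ^+ n.
Proof.
move=> r01 hu; have /andP[r0 r1] := r01.
have hK m n : cabs (u (n + m)%N - u n) <= K / (1 - r) * (r ^+ n - r ^+ (n + m)).
  elim: m => [|m IHm]; first by rewrite addn0 !subrr cabs0 mulr0.
  have := cabs_trans (u (n + m)%N) (u (n + m.+1)%N) (u n).
  have := hu (n + m)%N; rewrite -addnS addnS exprSr.
  have -> : K / (1 - r) * (r ^+ n - r ^+ (n + m) * r) =
    K / (1 - r) * (r ^+ n - r ^+ (n + m)) + K * r ^+ (n + m) by field; lra.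
  by move: IHm; lra.
have K0 : 0 <= K by have := hu 0%N; have := cabs_ge0 (u 1%N - u 0%N); rewrite expr0; lra.
have Kr : 0 <= K / (1 - r) by rewrite divr_ge0 // subr_ge0 ltW.
have hK' m n : (n <= m)%N -> cabs (u m - u n) <= K / (1 - r) * r ^+ n.
  move=> nm; have := hK (m - n)%N n; rewrite subnKC // => h; apply: le_trans h _.
  by rewrite ler_wpM2l // gerBl exprn_ge0.
have [l hl] : exists l, clim u l.
  apply: clim_cauchy => e e0.
  have [N hN] := geom_lt (2 * (K / (1 - r))) r01 e0.
  exists N => m n Nm Nn; have := hN _ (leqnn _).
  have := hK' _ _ Nm; have := hK' _ _ Nn; have := cabs_trans (u N) (u m) (u n).
  rewrite (cabsC (u N)); lra.
exists l => // n; apply/ler_addgt0Pl => e /hl[N hN].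
have := hN (maxn n N) (leq_maxr _ _); have := hK' _ _ (leq_maxl n N).
have := cabs_trans (u (maxn n N)) (u n) l; rewrite (cabsC (u n) (u _)); lra.
Qed.

End ComplexSequences.

(** * Integration over [0, 1] and Goursat's theorem *)

Section DyadicIntegral.
Variable R : realType.
Implicit Types (g h : R -> R[i]) (t e : R).

Definition rcont g := forall t, dcont (@rdist R) g t.

(** The left Riemann sum with 2^n nodes. Recursion on halves builds in the subdivision of the
    interval, the only change of variable that Goursat's theorem asks for. *)
Fixpoint dyadic_sum n g : R[i] :=
  if n is n'.+1 then
    2^-1 * (dyadic_sum n' (fun t => g (t / 2)) + dyadic_sum n' (fun t => g ((t + 1) / 2)))
  else g 0.

(* The integral of g over [0, 1]; a meaningful value only for continuous g. *)
Definition cint g : R[i] := xget 0 (clim (fun n => dyadic_sum n g)).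

(** The majorant is complex-valued, so no separate real integral is required; in Fejer's argument it
    is made from the kernel itself. *)
Lemma dyadic_sum_le n g h :
  (forall t, 0 <= t <= 1 -> cabs (g t) <= complex.Re (h t)) ->
  cabs (dyadic_sum n g) <= complex.Re (dyadic_sum n h).
Proof.
elim: n g h => [|n IHn] g h gh /=; first by apply: gh; rewrite lexx ler01.
rewrite cabsM.
have -> : cabs (2^-1 : R[i]) = 2^-1 by rewrite cabsV cabs_nat.
have ReM (z : R[i]) : complex.Re (2^-1 * z) = 2^-1 * complex.Re z.
  case: z => a b; have -> : (2^-1 : R[i]) = (2^-1 : R)%:C.
    by rewrite fmorphV rmorph_nat.
  by rewrite /= mul0r subr0.
have ReD (z w : R[i]) : complex.Re (z + w) = complex.Re z + complex.Re w.
  by case: z w => [? ?] [? ?].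
rewrite ReM ReD ler_pM2l ?invr_gt0 //; apply: le_trans (cabsD _ _) _.
by apply: lerD; apply: IHn => t /andP[t0 t1]; apply: gh; apply/andP; split; lra.
Qed.

Lemma dyadic_sumZ n c g : dyadic_sum n (fun t => c * g t) = c * dyadic_sum n g.
Proof. by elim: n g => [//|n IHn] g /=; rewrite !IHn -mulrDr mulrCA. Qed.

Lemma dyadic_sumD n g h :
  dyadic_sum n (fun t => g t + h t) = dyadic_sum n g + dyadic_sum n h.
Proof. by elim: n g h => [//|n IHn] g h /=; rewrite !IHn -mulrDr addrACA. Qed.

Lemma dyadic_sum_cst n c : dyadic_sum n (fun=> c) = c.
Proof. by elim: n => [//|n /= ->]; field. Qed.

(** Passing to a half doubles the scale of the oscillation hypothesis. After [n] halvings it covers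
    all of [0, 1], where every node value is within [e] of the value at 0. *)
Lemma dyadic_sum_osc n m g e :
  (forall s t, 0 <= s <= 1 -> 0 <= t <= 1 -> `|s - t| <= 2^-1 ^+ n -> cabs (g s - g t) <= e) ->
  cabs (dyadic_sum (n + m) g - dyadic_sum n g) <= e.
Proof.
elim: n g => [|n IHn] g hg.
  rewrite add0n; have -> : dyadic_sum m g - dyadic_sum 0 g = dyadic_sum m (fun t => g t + - g 0).
    by rewrite dyadic_sumD dyadic_sum_cst.
  rewrite -[e](_ : complex.Re (dyadic_sum m (fun=> e%:C)) = e); last by rewrite dyadic_sum_cst.
  apply: dyadic_sum_le => t /andP[t0 t1]; apply: hg; rewrite ?t0 ?t1 ?lexx ?ler01 //.
  by rewrite subr0 ger0_norm.
rewrite addSn /= -mulrBr opprD addrACA cabsM.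
have -> : cabs (2^-1 : R[i]) = 2^-1 by rewrite cabsV cabs_nat.
rewrite -ler_pdivlMl ?invr_gt0 // invrK; apply: le_trans (cabsD _ _) _.
have -> : 2 * e = e + e by ring.
by apply: lerD; apply: IHn => s t /andP[s0 s1] /andP[t0 t1] st; apply: hg;
  try (apply/andP; split; lra); rewrite exprS;
  [have -> : s / 2 - t / 2 = 2^-1 * (s - t) by field
  |have -> : (s + 1) / 2 - (t + 1) / 2 = 2^-1 * (s - t) by field];
  rewrite normrM gtr0_norm // ler_pM2l.
Qed.

Lemma rcont_uniform g e : rcont g -> 0 < e -> exists n, forall s t,
  0 <= s <= 1 -> 0 <= t <= 1 -> `|s - t| <= 2^-1 ^+ n -> cabs (g s - g t) < e.
Proof.
move=> gc e0; apply: contrapT => hn.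
have /choice[p hp] : forall n, exists p : R * R, [/\ 0 <= p.1 <= 1,
    `|p.1 - p.2| <= 2^-1 ^+ n & e <= cabs (g p.1 - g p.2)].
  move=> n; apply: contrapT => hp; apply: hn; exists n => s t s01 t01 st.
  by rewrite ltNge; apply/negP => ge; apply: hp; exists (s, t).
(* Compactness gives a cluster point [x] of the first components of the bad pairs; continuity at [x]
   contradicts the gap [e] along pairs that shrink to it. *)
have [|x [_ clx]] := @segment_compact R 0 1 ((fun n => (p n).1) @ \oo)%classic _.
  by exists 0%N => // n _ /=; have [h _ _] := hp n; rewrite in_itv.
have [r r0 hr] := gc x (e / 2) ltac:(lra).
have [N hN] := @geom_lt R 1 (r / 2) 2^-1 ltac:(lra) ltac:(lra).
have r2 : 0 < r / 2 by lra.
have nbx : nbhs x (ball x (r / 2)) by apply/nbhs_ballP; exists (r / 2).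
have Fs : ((fun n => (p n).1) @ \oo)%classic ((fun n => (p n).1) @` [set n | (N <= n)%N])%classic.
  by exists N => // n Nn; exists n.
have [y [[n /= Nn <-]]] := clx _ _ Fs nbx.
have [_ h1 h2] := hp n; rewrite /ball /= => h3; have := hN _ Nn; rewrite mul1r => h4.
have := hr (p n).1; rewrite /rdist distrC => /(_ ltac:(lra)) h5.
have := ler_distD (p n).1 (p n).2 x; rewrite (distrC (p n).2 (p n).1) (distrC (p n).1 x) => h6.
have := hr (p n).2; rewrite /rdist => /(_ ltac:(lra)) h7.
have := cabs_trans (g x) (g (p n).1) (g (p n).2); rewrite (cabsC (g x)); lra.
Qed.

Lemma cintP g : rcont g -> clim (fun n => dyadic_sum n g) (cint g).
Proof.
move=> gc; suff [l hl] : exists l, clim (fun n => dyadic_sum n g) l.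
  exact: (xgetI 0 hl).
apply: clim_cauchy => e e0.
have [N hN] := rcont_uniform gc (ltac:(lra) : 0 < e / 3).
have hm m : (N <= m)%N -> cabs (dyadic_sum m g - dyadic_sum N g) <= e / 3.
  move=> Nm; rewrite -(subnKC Nm); apply: dyadic_sum_osc => s t s01 t01 st.
  exact/ltW/hN.
exists N => m n /hm h1 /hm h2.
have := cabs_trans (dyadic_sum N g) (dyadic_sum m g) (dyadic_sum n g).
rewrite (cabsC (dyadic_sum N g)); lra.
Qed.

Lemma rcont_affine (a b : R) g : rcont g -> rcont (fun t => g (t * a + b)).
Proof.
move=> gc t e e0; have [r r0 hr] := gc (t * a + b) _ e0.
have a0 := normr_ge0 a; exists (r / (1 + `|a|)); first by apply: divr_gt0 => //; lra.
move=> s; rewrite /rdist ltr_pdivlMr; last by lra.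
move=> st; apply: hr; rewrite /rdist (_ : _ - _ = (s - t) * a); last by ring.
by rewrite normrM; have := normr_ge0 (s - t); nra.
Qed.

Lemma rcont_halfl g : rcont g -> rcont (fun t => g (t / 2)).
Proof. by move=> /(@rcont_affine 2^-1 0) gc t; apply: dcont_eq (gc t) => s; rewrite addr0. Qed.

Lemma rcont_halfr g : rcont g -> rcont (fun t => g ((t + 1) / 2)).
Proof.
by move=> /(@rcont_affine 2^-1 2^-1) gc t; apply: dcont_eq (gc t) => s; rewrite mulrDl mul1r.
Qed.

Lemma cint_half g : rcont g ->
  cint g = 2^-1 * (cint (fun t => g (t / 2)) + cint (fun t => g ((t + 1) / 2))).
Proof.
move=> gc; apply: (clim_unique (clim_shift (cintP gc))).
by apply: climZ; apply: climD; apply: cintP; [exact: rcont_halfl|exact: rcont_halfr].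
Qed.

Lemma cint_eq g h : g =1 h -> cint g = cint h.
Proof. by move=> /funext ->. Qed.

Lemma cintD g h : rcont g -> rcont h -> cint (fun t => g t + h t) = cint g + cint h.
Proof.
move=> gc hc; have gh : rcont (fun t => g t + h t) by move=> t; exact: dcontD.
apply: (clim_unique (cintP gh)); apply: clim_eq (climD (cintP gc) (cintP hc)) => n.
by rewrite dyadic_sumD.
Qed.

Lemma cintZ c g : rcont g -> cint (fun t => c * g t) = c * cint g.
Proof.
move=> gc; have cg : rcont (fun t => c * g t).
  by move=> t; apply: dcontM => //; exact: dcont_cst.
apply: (clim_unique (cintP cg)); apply: clim_eq (climZ c (cintP gc)) => n.
by rewrite dyadic_sumZ.
Qed.

Lemma cint_cst c : cint (fun=> c) = c.
Proof.
have cc : rcont (fun=> c) by move=> t; exact: dcont_cst.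
by apply: (clim_unique (cintP cc)); apply: clim_eq (clim_cst c) => n; rewrite dyadic_sum_cst.
Qed.

Lemma rcont_sum n (F : 'I_n -> R -> R[i]) : (forall k, rcont (F k)) ->
  rcont (fun t => \sum_k F k t).
Proof.
elim: n F => [|n IHn] F hF t.
  by apply: dcont_eq (dcont_cst _ 0 t) => s; rewrite big_ord0.
apply: (@dcont_eq _ _ _ (fun s => F ord0 s + \sum_(i < n) F (lift ord0 i) s)).
  by move=> s; rewrite big_ord_recl.
by apply: dcontD; [exact: hF|exact: (IHn (fun i => F (lift ord0 i)))].
Qed.

Lemma cint_sum n (F : 'I_n -> R -> R[i]) : (forall k, rcont (F k)) ->
  cint (fun t => \sum_k F k t) = \sum_k cint (F k).
Proof.
elim: n F => [|n IHn] F hF.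
  by rewrite big_ord0 -[RHS](cint_cst 0); apply: cint_eq => t; rewrite big_ord0.
rewrite big_ord_recl -IHn // -cintD //.
  by apply: cint_eq => t; rewrite big_ord_recl.
exact: rcont_sum.
Qed.

Lemma cint_le g h : rcont g -> rcont h ->
  (forall t, 0 <= t <= 1 -> cabs (g t) <= complex.Re (h t)) ->
  cabs (cint g) <= complex.Re (cint h).
Proof.
move=> gc hc gh; apply/ler_addgt0Pl => e e0.
have [N hN] := cintP gc (ltac:(lra) : 0 < e / 2).
have [N' hN'] := cintP hc (ltac:(lra) : 0 < e / 2).
have := hN _ (leq_maxl N N'); have := hN' _ (leq_maxr N N').
have := dyadic_sum_le (maxn N N') gh.
move: (dyadic_sum _ g) (dyadic_sum _ h) => u v uv /(le_lt_trans (Re_le_cabs _)).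
rewrite (_ : complex.Re (v - cint h) = complex.Re v - complex.Re (cint h)); last first.
  by case: v (cint h) {uv} => [? ?] [? ?].
rewrite ltr_distl => /andP[h1 h2] h3; have := cabsB (cint g) u; rewrite cabsC; lra.
Qed.

Lemma cint_bound g (K : R) : rcont g -> (forall t, 0 <= t <= 1 -> cabs (g t) <= K) ->
  cabs (cint g) <= K.
Proof.
move=> gc gK; have := @cint_le g (fun=> K%:C) gc (fun t => dcont_cst _ _ t) gK.
by rewrite cint_cst.
Qed.

(** Halving the interval turns the integral J into the equation J = J/2 + a/2 + b/4. *)
Lemma cint_affine (a b : R[i]) : cint (fun t : R => a + t%:C * b) = a + b / 2.
Proof.
have gc : rcont (fun t : R => a + t%:C * b) by move=> t; exact: dcont_real.
set J := cint _; have := cint_half gc; rewrite -/J.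
have -> : cint (fun t : R => a + (t / 2)%:C * b) = 2^-1 * (J + a).
  rewrite -{2}(cint_cst a) -cintD // => [|t]; last exact: dcont_cst.
  rewrite -cintZ => [|t]; last by apply: dcontD => //; exact: dcont_cst.
  by apply: cint_eq => t; rewrite rmorphM /= fmorphV rmorph_nat; field.
have -> : cint (fun t : R => a + ((t + 1) / 2)%:C * b) = 2^-1 * (J + (a + b)).
  rewrite -(cint_cst (a + b)) -cintD // => [|t]; last exact: dcont_cst.
  rewrite -cintZ => [|t]; last by apply: dcontD => //; exact: dcont_cst.
  by apply: cint_eq => t; rewrite rmorphM rmorphD rmorph1 /= fmorphV rmorph_nat; field.
move=> hJ; have -> : J = 2 * J - J by ring.
by rewrite {1}hJ; field.
Qed.

End DyadicIntegral.

(** * Goursat's theorem for parallelograms *)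

Section Goursat.
Variable R : realType.
Implicit Types (G : R[i] -> R[i]) (a u v w : R[i]).

Definition seg_mean G a u : R[i] := cint (fun t : R => G (a + t%:C * u)).

(* Contour integral of G along the parallelogram a, a + u, a + u + v, a + v. *)
Definition contour G a u v : R[i] :=
  u * (seg_mean G a u - seg_mean G (a + v) u) + v * (seg_mean G (a + u) v - seg_mean G a v).

Lemma rcont_seg G a u : (forall w, dcont (@cdist R) G w) ->
  rcont (fun t : R => G (a + t%:C * u)).
Proof.
move=> Gc t; apply: (@dcont_comp _ _ _ (fun t : R => a + t%:C * u)) => //.
exact: dcont_real.
Qed.

Lemma seg_mean_half G a u : (forall w, dcont (@cdist R) G w) ->
  seg_mean G a u = 2^-1 * (seg_mean G a (u / 2) + seg_mean G (a + u / 2) (u / 2)).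
Proof.
move=> Gc; rewrite {1}/seg_mean cint_half; last exact: rcont_seg.
by congr (_ * (_ + _)); apply: cint_eq => t; congr (G _);
  rewrite rmorphM ?rmorphD ?rmorph1 /= fmorphV rmorph_nat; field.
Qed.

Lemma contour_split G a u v : (forall w, dcont (@cdist R) G w) ->
  contour G a u v =
    (contour G a (u / 2) (v / 2) + contour G (a + u / 2) (u / 2) (v / 2)) +
    (contour G (a + v / 2) (u / 2) (v / 2) + contour G (a + u / 2 + v / 2) (u / 2) (v / 2)).
Proof.
move=> Gc; rewrite {1}/contour (seg_mean_half a u) // (seg_mean_half (a + v) u) //.
rewrite (seg_mean_half (a + u) v) // (seg_mean_half a v) // /contour.
have hu : u = u / 2 + u / 2 by field.
have hv : v = v / 2 + v / 2 by field.
have -> : a + v = a + v / 2 + v / 2 by rewrite {1}hv addrA.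
have -> : a + u = a + u / 2 + u / 2 by rewrite {1}hu addrA.
have -> : a + u / 2 + u / 2 + v / 2 = a + u / 2 + v / 2 + u / 2 by rewrite addrAC.
have -> : a + v / 2 + v / 2 + u / 2 = a + u / 2 + v / 2 + v / 2 by ring.
have -> : a + v / 2 + u / 2 = a + u / 2 + v / 2 by rewrite addrAC.
by field.
Qed.

(** An affine function has zero contour integral, so [G] may be replaced by its first-order
    remainder at [w], which is at most [M] on each of the four sides. *)
Lemma contour_remainder G a u v w l (M : R) : (forall z, dcont (@cdist R) G z) ->
  (forall s t : R, 0 <= s <= 1 -> 0 <= t <= 1 -> forall z, z = a + s%:C * u + t%:C * v ->
     cabs (G z - G w - l * (z - w)) <= M) ->
  cabs (contour G a u v) <= 2 * (cabs u + cabs v) * M.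
Proof.
move=> Gc hM.
pose g z := G z - G w - l * (z - w).
have gc z : dcont (@cdist R) g z.
  apply: dcontB; first by apply: dcontB => //; exact: dcont_cst.
  apply: dcontM; first exact: dcont_cst.
  by apply: dcontB; [exact: dcont_id|exact: dcont_cst].
have segE b d : seg_mean G b d = seg_mean g b d + (G w + l * (b + d / 2 - w)).
  have -> : G w + l * (b + d / 2 - w) = (G w + l * (b - w)) + (l * d) / 2 by ring.
  rewrite -cint_affine -cintD; last 2 first.
  - exact: rcont_seg.
  - by move=> t; exact: dcont_real.
  by apply: cint_eq => t; rewrite /g; ring.
have -> : contour G a u v = contour g a u v by rewrite /contour !segE; field.
have E0 (t : R) (z : R[i]) : a + t%:C * z = a + 0%:C * u + t%:C * z.
  by rewrite rmorph0 mul0r addr0.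
have b1 (b d : R[i]) : (forall t : R, 0 <= t <= 1 -> cabs (g (b + t%:C * d)) <= M) ->
   cabs (seg_mean g b d) <= M.
  by move=> h; apply: cint_bound => //; exact: rcont_seg.
have i0 : 0 <= (0 : R) <= 1 by rewrite lexx ler01.
have i1 : 0 <= (1 : R) <= 1 by rewrite lexx ler01.
have h1 : cabs (seg_mean g a u) <= M.
  by apply: b1 => t t01; apply: (hM t 0) => //; rewrite rmorph0; ring.
have h2 : cabs (seg_mean g (a + v) u) <= M.
  by apply: b1 => t t01; apply: (hM t 1) => //; rewrite rmorph1; ring.
have h3 : cabs (seg_mean g (a + u) v) <= M.
  by apply: b1 => t t01; apply: (hM 1 t) => //; rewrite rmorph1; ring.
have h4 : cabs (seg_mean g a v) <= M.
  by apply: b1 => t t01; apply: (hM 0 t) => //; rewrite rmorph0; ring.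
apply: le_trans (cabsD _ _) _; rewrite !cabsM.
have := cabsD (seg_mean g a u) (- seg_mean g (a + v) u).
have := cabsD (seg_mean g (a + u) v) (- seg_mean g a v).
rewrite !cabsN; have := cabs_ge0 u; have := cabs_ge0 v.
set A := cabs (_ - _); set B := cabs (_ - _); nra.
Qed.

Lemma goursat G a u v : (forall w, cdiff G w) -> contour G a u v = 0.
Proof.
move=> Gd; have Gc w : dcont (@cdist R) G w by exact: cdiff_cont.
pose h n : R[i] := 2^-1 ^+ n.
pose K := cabs u + cabs v.
have K0 : 0 <= K by rewrite addr_ge0 ?cabs_ge0.
pose c := cabs (contour G a u v).
have ch n : cabs (h n) = 2^-1 ^+ n by rewrite /h cabsX cabsV cabs_nat.
(* A parallelogram of the n-th subdivision is bad if it still carries at least 4^-n of the original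
   modulus; one quarter of a bad one is bad again. *)
pose bad n b := c * 4^-1 ^+ n <= cabs (contour G b (u * h n) (v * h n)).
have /choice[f hf] : forall p : nat * R[i], exists b', bad p.1 p.2 ->
    bad p.1.+1 b' /\ cabs (b' - p.2) <= K * 2^-1 ^+ p.1.
  move=> [n b] /=; have hS z : z * h n / 2 = z * h n.+1 by rewrite /h exprSr mulrA.
  apply: contrapT => hn; have big d : cabs d <= K * 2^-1 ^+ n -> bad n b ->
      cabs (contour G (b + d) (u * h n.+1) (v * h n.+1)) < c * 4^-1 ^+ n.+1.
    move=> hd bn; rewrite ltNge; apply/negP => hb; apply: hn; exists (b + d) => _.
    by split=> //; rewrite [b + d]addrC addrK.
  (* The witness 0 is a dummy: it only exposes [bad n b], which the strict bounds on all four
     quarters then refute. *)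
  apply: hn; exists 0 => bn; exfalso; move: (bn); apply/negP; rewrite -ltNge.
  rewrite contour_split // !hS.
  have p0 : 0 <= (2^-1 : R) ^+ n.+1 by rewrite exprn_ge0.
  have u0 := cabs_ge0 u; have v0 := cabs_ge0 v.
  have eu : cabs (u * h n.+1) = cabs u * 2^-1 ^+ n.+1 by rewrite cabsM ch.
  have ev : cabs (v * h n.+1) = cabs v * 2^-1 ^+ n.+1 by rewrite cabsM ch.
  have e2 : (2^-1 : R) ^+ n = 2 * 2^-1 ^+ n.+1 by rewrite exprS mulrA mulfV ?mul1r.
  have e4 : c * 4^-1 ^+ n = 4 * (c * 4^-1 ^+ n.+1) by rewrite exprS; field.
  have := big 0 ltac:(by rewrite cabs0 mulr_ge0 ?exprn_ge0) bn; rewrite addr0.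
  have := big (u * h n.+1) ltac:(by rewrite eu e2 /K; nra) bn.
  have := big (v * h n.+1) ltac:(by rewrite ev e2 /K; nra) bn.
  have := big (u * h n.+1 + v * h n.+1)
    ltac:(by apply: le_trans (cabsD _ _) _; rewrite eu ev e2 /K; nra) bn.
  rewrite e4 addrA => h4 h3 h2 h1; apply: le_lt_trans (cabsD _ _) _.
  apply: le_lt_trans (lerD (cabsD _ _) (cabsD _ _)) _; lra.
pose b := fix b n := if n is n'.+1 then f (n', b n') else a.
have bbad n : bad n (b n).
  elim: n => [|n IHn]; first by rewrite /bad /h !expr0 !mulr1.
  by have [] := hf (n, b n) IHn.
have [w hw] : exists w, forall n, cabs (b n - w) <= 2 * K * 2^-1 ^+ n.
  have [|n|w _ hw] := @clim_geom R b K 2^-1; first by lra.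
    by have [] := hf (n, b n) (bbad n).
  exists w => n; apply: le_trans (hw n) _.
  by rewrite (_ : K / _ = 2 * K) //; field.
apply: cabs_small => e e0; rewrite -/c.
have /cdiffP[l hl] := Gd w.
(* All points of the N-th parallelogram are within 3 K 2^-N of [w]: 2 K 2^-N for its corner and K
   2^-N for its size. The perimeter factor 2 K 2^-N then gives 6 K^2 4^-N; adding 1 keeps the
   divisor positive. *)
have k0 : 0 < 1 + 6 * K ^+ 2 by nra.
have [r r0 hr] := hl (e / (1 + 6 * K ^+ 2)) (divr_gt0 e0 k0).
have [N hN] := @geom_lt R (3 * K) r 2^-1 ltac:(lra) r0.
have p0 : 0 <= (2^-1 : R) ^+ N by rewrite exprn_ge0.
have eu : cabs (u * h N) = cabs u * 2^-1 ^+ N by rewrite cabsM ch.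
have ev : cabs (v * h N) = cabs v * 2^-1 ^+ N by rewrite cabsM ch.
have near (s t : R) : 0 <= s <= 1 -> 0 <= t <= 1 ->
    cabs (b N + s%:C * (u * h N) + t%:C * (v * h N) - w) <= 3 * K * 2^-1 ^+ N.
  move=> /andP[s0 s1] /andP[t0 t1].
  have -> : b N + s%:C * (u * h N) + t%:C * (v * h N) - w =
    (b N - w) + (s%:C * (u * h N) + t%:C * (v * h N)) by ring.
  apply: le_trans (cabsD _ _) _; have := cabsD (s%:C * (u * h N)) (t%:C * (v * h N)).
  rewrite (cabsM s%:C) (cabsM t%:C) !cabsR !ger0_norm // eu ev.
  have := hw N; have := cabs_ge0 u; have := cabs_ge0 v; rewrite /K => v0 u0.
  have := ler_piMl (mulr_ge0 u0 p0) s1; have := ler_piMl (mulr_ge0 v0 p0) t1; lra.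
have := @contour_remainder G (b N) (u * h N) (v * h N) w l
  (e / (1 + 6 * K ^+ 2) * (3 * K * 2^-1 ^+ N)) Gc.
have hrem : forall s t : R, 0 <= s <= 1 -> 0 <= t <= 1 ->
    forall z, z = b N + s%:C * (u * h N) + t%:C * (v * h N) ->
    cabs (G z - G w - l * (z - w)) <= e / (1 + 6 * K ^+ 2) * (3 * K * 2^-1 ^+ N).
  move=> s t s01 t01 z ->; have hz := near s t s01 t01.
  apply: le_trans (hr _ (le_lt_trans hz (hN _ (leqnn _)))) _.
  by rewrite ler_wpM2l // ltW // divr_gt0.
move=> /(_ hrem); rewrite eu ev -mulrDl -/K => hc.
have := le_trans (bbad N) hc.
have -> : 2 * (K * 2^-1 ^+ N) * (e / (1 + 6 * K ^+ 2) * (3 * K * 2^-1 ^+ N)) =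
    (6 * K ^+ 2 / (1 + 6 * K ^+ 2) * e) * 4^-1 ^+ N.
  have -> : (4^-1 : R) = 2^-1 * 2^-1 by field.
  by rewrite exprMn; field; lra.
rewrite ler_pM2r ?exprn_gt0 // => /le_trans; apply.
rewrite ler_piMl //; first exact: ltW.
by rewrite ler_pdivrMr //; lra.
Qed.

(** The two sides in direction [u] differ by the period and cancel, which leaves the two sides along
    the period. *)
Lemma goursat_periodic G a u v : v != 0 -> (forall w, cdiff G w) ->
  (forall w, G (w + v) = G w) -> seg_mean G (a + u) v = seg_mean G a v.
Proof.
move=> v0 Gd Gp; have := goursat a u v Gd; rewrite /contour.
have -> : seg_mean G (a + v) u = seg_mean G a u.
  by apply: cint_eq => t; rewrite addrAC Gp.
by rewrite subrr mulr0 add0r => /eqP; rewrite mulf_eq0 (negPf v0) subr_eq0 => /eqP.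
Qed.

End Goursat.

(** * Laurent coefficients *)

Section ComplexExponential.
Variable R : realType.
Implicit Types (z w : R[i]).

Definition cexp z : R[i] :=
  (expR (complex.Re z))%:C * (cos (complex.Im z) +i* sin (complex.Im z)).

Lemma cexpD z w : cexp (z + w) = cexp z * cexp w.
Proof.
case: z w => [a b] [c d]; rewrite /cexp /= expRD cosD sinD rmorphM /=.
rewrite mulrACA; congr (_ * _); apply/eqP; rewrite eq_complex /=.
rewrite [sin b * _ + _]addrC [sin b * _]mulrC [cos b * sin d]mulrC.
by apply/andP; split; apply/eqP; ring.
Qed.

Lemma cexp0 : cexp 0 = 1.
Proof. by rewrite /cexp /= expR0 cos0 sin0 mul1r. Qed.

Lemma cexp_neq0 z : cexp z != 0.
Proof.
apply/eqP => h; have := cexpD z (- z); rewrite subrr cexp0 h mul0r => /eqP.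
by rewrite oner_eq0.
Qed.

Definition tau : R[i] := 0 +i* (pi *+ 2).

Lemma tau_neq0 : tau != 0.
Proof.
rewrite eq_complex /= eqxx /= mulrn_eq0 /=; apply: lt0r_neq0; exact: pi_gt0.
Qed.

Lemma cexp_tau : cexp tau = 1.
Proof. by rewrite /cexp /= expR0 cos2pi sin2pi mul1r. Qed.

Lemma cexp_surj z : z != 0 -> exists w, cexp w = z.
Proof.
move=> z0; have c0 : 0 < cabs z by rewrite cabs_gt0.
have cE : cabs z ^+ 2 = complex.Re z ^+ 2 + complex.Im z ^+ 2.
  by apply: complexI; rewrite rmorphXn /= -cabsE add_Re2_Im2.
case: z z0 c0 cE => a b /= z0 c0 cE; set c := cabs _ in c0 cE.
have cn : c != 0 by rewrite gt_eqF.
have h1 : (a / c) ^+ 2 + (b / c) ^+ 2 = 1.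
  by rewrite !expr_div_n -mulrDl -cE divff // expf_neq0.
have ac : -1 <= a / c <= 1.
  rewrite -ler_norml -(@ler_pXn2r _ 2) ?nnegrE ?normr_ge0 ?ler01 //.
  by rewrite real_normK ?num_real // expr1n -h1 lerDl sqr_ge0.
have sE : sin (acos (a / c)) = `|b / c|.
  rewrite sin_acos // (_ : 1 - _ = (b / c) ^+ 2) ?sqrtr_sqr //.
  by rewrite -h1; ring.
have key t : cos t = a / c -> sin t = b / c -> cexp (ln c +i* t) = a +i* b.
  move=> ht st; rewrite /cexp /= lnK ?posrE // ht st.
  by apply/eqP; rewrite eq_complex /= !mul0r subr0 addr0 !(mulrC c) !mulfVK // !eqxx.
have [b0|b0] := lerP 0 b.
  exists (ln c +i* acos (a / c)); apply: key; first by rewrite acosK.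
  by rewrite sE ger0_norm // divr_ge0 // ltW.
exists (ln c +i* (- acos (a / c))); apply: key; first by rewrite cosN acosK.
by rewrite sinN sE ler0_norm ?opprK // mulr_le0_ge0 ?invr_ge0 // ltW.
Qed.

Lemma is_derive_slope (f : R -> R) (x l : R) : is_derive x 1 f l ->
  forall e : R, 0 < e -> exists2 r : R, 0 < r & forall h, `|h| < r ->
    `|f (x + h) - f x - l * h| <= e * `|h|.
Proof.
move=> [fd <-] e e0; have /cvgrPdist_lt/(_ _ e0)/nbhs_ballP[r /= r0 hr] := fd.
exists r => // h hr'; have [->|h0] := eqVneq h 0.
  by rewrite addr0 subrr mulr0 subrr normr0 mulr0.
have := hr h; rewrite /ball /= sub0r normrN => /(_ hr' h0).
rewrite [_ *: 1]mulr1 (addrC h) distrC => /ltW.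
have h1 : 0 < `|h| by rewrite normr_gt0.
rewrite -(ler_pM2r h1) -normrM mulrBl [_ *: _]mulrC mulfVK //.
Qed.

(** The addition formula reduces everything to the derivative at 0, read off from those of the real
    exponential, cosine and sine. *)
Lemma cdiff_cexp z : cdiff cexp z.
Proof.
apply/cdiffP; exists (cexp z) => e e0.
have E0 : 0 < cabs (cexp z) by rewrite cabs_gt0 cexp_neq0.
(* The 8 is 3 + 5, the constants of the estimates [re] and [im] below. *)
pose d := Num.min 1 (e / (8 * cabs (cexp z))).
have d0 : 0 < d by rewrite lt_min ltr01 divr_gt0 // mulr_gt0.
have d1 : d <= 1 by rewrite ge_min lexx.
have de : 8 * d * cabs (cexp z) <= e.
  by rewrite mulrAC mulrC -ler_pdivlMr ?mulr_gt0 // ge_min lexx orbT.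
clearbody d; have [r1 r10 hr1] := is_derive_slope (is_derive_expR 0) d0.
have [r2 r20 hr2] := is_derive_slope (is_derive_cos 0) d0.
have [r3 r30 hr3] := is_derive_slope (is_derive_sin 0) d0.
exists (Num.min (Num.min r1 r2) (Num.min r3 d)); first by rewrite !lt_min r10 r20 r30 d0.
move=> w; set h := w - z; rewrite !lt_min => /andP[/andP[h1 h2] /andP[h3 h4]].
have -> : cexp w = cexp z * cexp h by rewrite -cexpD addrC subrK.
have -> : cexp z * cexp h - cexp z - cexp z * h = cexp z * (cexp h - 1 - h) by ring.
rewrite cabsM; apply: le_trans (ler_wpM2r (cabs_ge0 h) de).
rewrite (mulrC (8 * d)) -mulrA ler_pM2l //.
have Re_h := Re_le_cabs h; have Im_h := Im_le_cabs h.
have := hr1 _ (le_lt_trans Re_h h1); have := hr2 _ (le_lt_trans Im_h h2).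
have := hr3 _ (le_lt_trans Im_h h3); have h0 := cabs_ge0 h.
rewrite !add0r expR0 cos0 sin0 oppr0 mul0r !mul1r !subr0.
have := cabs_le_ReIm (cexp h - 1 - h); rewrite /cexp.
move: h4 h0 Re_h Im_h; set H := cabs h; case: (h) => a b /=; rewrite !mul0r !subr0 addr0.
move: (cos_le1 b) (cos_geN1 b); set C := cos b; set S := sin b; set X := expR a.
move=> c1 cN1 hd H0 ha hb hC hS hE hX.
have re : `|X * C - 1 - a| <= 3 * d * H.
  have -> : X * C - 1 - a = (X - 1 - a) * C + (1 + a) * (C - 1) by ring.
  apply: le_trans (ler_normD _ _) _; rewrite !normrM.
  have nC : `|C| <= 1 by rewrite ler_norml cN1 c1.
  have na : `|1 + a| <= 2 by apply: le_trans (ler_normD _ _) _; rewrite normr1; lra.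
  have := ler_pM (normr_ge0 _) (normr_ge0 _) hX nC.
  have := ler_pM (normr_ge0 _) (normr_ge0 _) na hE.
  have := ler_wpM2l (ltW d0) ha; have := ler_wpM2l (ltW d0) hb; lra.
have im : `|X * S - b| <= 5 * d * H.
  have -> : X * S - b = (X - 1) * S + (S - b) by ring.
  rewrite addr0 in hS.
  apply: le_trans (ler_normD _ _) _; rewrite normrM.
  have := ler_wpM2l (ltW d0) ha; have := ler_wpM2l (ltW d0) hb => db da.
  have dH : d * H <= H by rewrite ler_piMl.
  have nS : `|S| <= 2 * H.
    have := ler_normD (S - b) b; rewrite subrK; lra.
  have nX : `|X - 1| <= 2 * H.
    have := ler_normD (X - 1 - a) a; rewrite subrK; lra.
  have := ler_pM (normr_ge0 _) (normr_ge0 _) nX nS.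
  have := ler_wpM2l H0 (ltW hd); lra.
by move: hC re im; lra.
Qed.

End ComplexExponential.

(** * Circle means and Fejer's theorem *)

Section CircleMeans.
Variable R : realType.
Implicit Types (f g : R[i] -> R[i]) (z w : R[i]) (n : int).

Local Notation e t := (cexp (t%:C * tau R)).

Definition cont_Cstar f := forall z, z != 0 -> dcont (@cdist R) f z.

Definition circle_mean f z : R[i] := cint (fun t : R => f (z * e t)).

Lemma circle_neq0 z (t : R) : z != 0 -> z * e t != 0.
Proof. by move=> z0; rewrite mulf_neq0 // cexp_neq0. Qed.

Lemma rcont_cexp : rcont (fun t : R => e t).
Proof.
move=> t; apply: (@dcont_comp _ _ _ (fun t : R => t%:C * tau R)).
  by apply: dcont_eq (dcont_real 0 (tau R) t) => s; rewrite add0r.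
exact/cdiff_cont/cdiff_cexp.
Qed.

Lemma rcont_circle f z : z != 0 -> cont_Cstar f -> rcont (fun t : R => f (z * e t)).
Proof.
move=> z0 fc t; apply: (@dcont_comp _ _ _ (fun t : R => z * e t)).
  by apply: dcontM; [exact: dcont_cst|exact: rcont_cexp].
exact/fc/circle_neq0.
Qed.

Lemma circle_mean_holo f z w : (forall u, u != 0 -> cdiff f u) -> z != 0 -> w != 0 ->
  circle_mean f z = circle_mean f w.
Proof.
move=> fd /cexp_surj[a <-] /cexp_surj[b <-].
pose G u := f (cexp u).
have Gd u : cdiff G u by apply: cdiff_comp; [exact: cdiff_cexp|exact/fd/cexp_neq0].
have Gp u : G (u + tau R) = G u by rewrite /G cexpD cexp_tau mulr1.
have E u : circle_mean f (cexp u) = seg_mean G u (tau R).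
  by apply: cint_eq => t; rewrite /G cexpD.
by rewrite !E -(subrK a b) addrC (goursat_periodic _ _ (tau_neq0 R) Gd Gp).
Qed.

(** By homogeneity the mean through [u] is [u ^ n] times the mean through 1, yet it does not depend
    on [u]. Taking [u] = 2 forces it to vanish when [n] is nonzero. *)
Lemma circle_mean_pow n z : z != 0 -> circle_mean (fun w => w ^ n) z = (n == 0)%:R.
Proof.
move=> z0; have [->|n0] := eqVneq n 0.
  by rewrite -[RHS](cint_cst 1); apply: cint_eq => t; rewrite expr0z.
have hd u : u != 0 -> cdiff (fun w => w ^ n) u by exact: cdiffXz.
have u1 : (1 : R[i]) != 0 by exact: oner_neq0.
have pc : cont_Cstar (fun w => w ^ n) by move=> u u0; exact/cdiff_cont/hd.
have E u : u != 0 -> circle_mean (fun w => w ^ n) u = u ^ n * circle_mean (fun w => w ^ n) 1.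
  move=> u0; rewrite -cintZ; last exact: (rcont_circle (f := fun w => w ^ n)).
  by apply: cint_eq => t; rewrite mul1r expfzMl.
have two0 : (2%:R : R[i]) != 0 by rewrite pnatr_eq0.
rewrite E //; have := E _ two0; rewrite (circle_mean_holo hd two0 u1).
set c := circle_mean _ _ => /eqP; rewrite -subr_eq0 -{1}[c]mul1r -mulrBl mulf_eq0.
case/orP => [|/eqP ->]; last by rewrite mulr0.
rewrite subr_eq0 eq_sym => /eqP h; exfalso.
have : cabs ((2%:R : R[i]) ^ n) = 1 by rewrite h cabs1.
by rewrite cabsXz cabs_nat => /eqP; rewrite pexprz_eq1 ?ler0n // (negPf n0) pnatr_eq1.
Qed.

(** With this sign convention it is the coefficient of [w ^ (- n)] in the Laurent expansion. *)
Definition laurent_coef f n z : R[i] := circle_mean (fun w => w ^ n * f w) z.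

(* Functions on C^* that behave as if they were the sum of a Laurent series with
   z-independent coefficients; unlike holomorphy this is visibly preserved by
   locally uniform limits. *)
Definition laurent f := cont_Cstar f /\
  forall n z w, z != 0 -> w != 0 -> laurent_coef f n z = laurent_coef f n w.

Lemma cont_pow n : cont_Cstar (fun w => w ^ n).
Proof. by move=> u u0; apply: dcontXz => //; exact: dcont_id. Qed.

Lemma cont_coef f n : cont_Cstar f -> cont_Cstar (fun w => w ^ n * f w).
Proof. by move=> fc u u0; apply: dcontM; [exact: cont_pow|exact: fc]. Qed.

Lemma holo_laurent f : (forall u, u != 0 -> cdiff f u) -> laurent f.
Proof.
move=> fd; split=> [z z0|n z w z0 w0]; first exact/cdiff_cont/fd.
apply: circle_mean_holo => // u u0; apply: cdiffM; last exact: fd.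
exact: cdiffXz.
Qed.

Lemma laurent_coefD f g n z : z != 0 -> cont_Cstar f -> cont_Cstar g ->
  laurent_coef (fun w => f w + g w) n z = laurent_coef f n z + laurent_coef g n z.
Proof.
move=> z0 /(@cont_coef _ n)/(rcont_circle z0) fc /(@cont_coef _ n)/(rcont_circle z0) gc.
by rewrite -cintD //; apply: cint_eq => t; rewrite mulrDr.
Qed.

Lemma laurent_coefZ c f n z : z != 0 -> cont_Cstar f ->
  laurent_coef (fun w => c * f w) n z = c * laurent_coef f n z.
Proof.
move=> z0 /(@cont_coef _ n)/(rcont_circle z0) fc.
by rewrite -cintZ //; apply: cint_eq => t; rewrite mulrCA.
Qed.

Lemma laurentD f g : laurent f -> laurent g -> laurent (fun w => f w + g w).
Proof.
move=> [fc fl] [gc gl]; split=> [z z0|n z w z0 w0].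
  by apply: dcontD; [exact: fc|exact: gc].
by rewrite !laurent_coefD // (fl n z w) // (gl n z w).
Qed.

Lemma laurentZ c f : laurent f -> laurent (fun w => c * f w).
Proof.
move=> [fc fl]; split=> [z z0|n z w z0 w0].
  by apply: dcontM; [exact: dcont_cst|exact: fc].
by rewrite !laurent_coefZ // (fl n z w).
Qed.

(** Walking from 0 to [t] in at most 2^n steps of length at most 2^-n raises the modulus by at most
    1 per step. *)
Lemma rcont_bounded (g : R -> R[i]) : rcont g ->
  exists B : R, forall t, 0 <= t <= 1 -> cabs (g t) <= B.
Proof.
move=> gc; have [n hn] := rcont_uniform gc (ltr01 (R := R)).
have p0 : 0 < (2^-1 : R) ^+ n by rewrite exprn_gt0.
have hk (k : nat) t : 0 <= t <= 1 -> t <= k%:R * 2^-1 ^+ n -> cabs (g t) <= cabs (g 0) + k%:R.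
  elim: k t => [|k IHk] t /andP[t0 t1].
    rewrite mul0r => t0'; have -> : t = 0 by apply/le_anti; rewrite t0 t0'.
    by rewrite addr0.
  rewrite -natr1 mulrDl mul1r => ht.
  pose s := Num.max 0 (t - 2^-1 ^+ n).
  have s01 : 0 <= s <= 1 by rewrite /s; case: (lerP 0 (t - 2^-1 ^+ n)) => ?; apply/andP; split; lra.
  have hs : s <= k%:R * 2^-1 ^+ n.
    by rewrite ge_max mulr_ge0 ?ler0n ?(ltW p0) //= lerBlDr.
  have st : `|t - s| <= 2^-1 ^+ n.
    by rewrite /s ler_norml; case: (lerP 0 (t - 2^-1 ^+ n)) => ?; apply/andP; split; lra.
  have := hn t s ltac:(by rewrite t0 t1) s01 st; have := IHk s s01 hs.
  have := cabsB (g t) (g s); lra.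
exists (cabs (g 0) + (2 ^ n)%N%:R) => t t01; apply: hk => //.
by rewrite natrX exprVn divff ?expf_neq0 //; case/andP: t01.
Qed.

Lemma cabs_circle (t : R) : cabs (e t) = 1.
Proof.
rewrite /cexp /= !mul0r !mulr0 subr0 expR0 mul1r addr0.
by apply: complexI; rewrite -cabsE normc_def /= cos2Dsin2 sqrtr1.
Qed.

Lemma conj_circle (t : R) : (e t)^-1 = (e t)^*.
Proof.
have := sqr_normc (e t); rewrite cabsE cabs_circle expr1n => h.
by rewrite -[RHS](mulKf (cexp_neq0 (t%:C * tau R))) -h mulr1.
Qed.

(** Multiplied out, the geometric sum is e^N - 1. This bounds the Fejer kernel, uniformly in [N],
    away from its peak. *)
Lemma geom_circle (N : nat) (t : R) :
  cabs (\sum_(k < N) e t ^+ k) * cabs (e t - 1) <= 2.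
Proof.
rewrite -cabsM mulrC -subrX1; apply: le_trans (cabsD _ _) _.
by rewrite cabsN cabs1 cabsX cabs_circle expr1n.
Qed.

(* The function is tested against the Fejer kernels |sum_(k < N) (w / z)^k|^2. *)
Lemma laurent_coef_inj f z : z != 0 -> cont_Cstar f ->
  (forall n, laurent_coef f n z = 0) -> f z = 0.
Proof.
move=> z0 fc f0; apply/eqP; apply: contraT => g0.
set c := f z; have c0 : 0 < cabs c by rewrite cabs_gt0.
have gc := rcont_circle z0 fc; have [B hB] := rcont_bounded gc.
have [r r0 hr] := fc z z0 (cabs c / 2) ltac:(lra).
(* [e t] is within [eta] of 1 exactly when [z * e t] is within [r] of [z]. *)
pose eta := r / cabs z.
have zc0 : 0 < cabs z by rewrite cabs_gt0.
have eta0 : 0 < eta by rewrite divr_gt0.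
(* Bounds the integrand away from the peak: [B + cabs c] for the function and [(2 / eta) ^+ 2] for
   the kernel. *)
pose K := (B + cabs c) * (2 / eta) ^+ 2.
(* [N] times the Fejer kernel, expanded into powers: its integral is [N], and its integral against
   [f] is a combination of coefficients, hence 0. *)
pose H (N : nat) (t : R) : R[i] := \sum_(j < N) \sum_(k < N) e t ^ (Posz j - Posz k).
have powc (n : int) : rcont (fun t : R => e t ^ n).
  by move=> t; apply: dcontXz; [exact: cexp_neq0|exact: rcont_cexp].
have Hc N : rcont (H N) by apply: rcont_sum => j; apply: rcont_sum => k; exact: powc.
have pow0 (n : int) : cint (fun t : R => e t ^ n) = (n == 0)%:R.
  rewrite -(circle_mean_pow n (oner_neq0 R[i])).
  by apply: cint_eq => t; rewrite mul1r.
have HN N : cint (H N) = N%:R.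
  rewrite cint_sum => [|j]; last by apply: rcont_sum => k; exact: powc.
  rewrite -[N in RHS]card_ord -sum1_card natr_sum; apply: eq_bigr => j _.
  rewrite cint_sum => [|k]; last exact: powc.
  rewrite (bigD1 j) //= pow0 subrr eqxx big1 ?addr0 // => k kj.
  by rewrite pow0 subr_eq0 eqz_nat eq_sym (inj_eq val_inj) (negPf kj).
have HE N t : H N t = (cabs (\sum_(k < N) e t ^+ k) ^+ 2)%:C.
  rewrite rmorphXn /= -cabsE sqr_normc rmorph_sum mulr_suml; apply: eq_bigr => j _.
  rewrite mulr_sumr; apply: eq_bigr => k _.
  by rewrite rmorphXn -[X in _ = _ * X ^+ k]/((e t)^*) -conj_circle expfzDr ?cexp_neq0 // exprVn -exprnN.
have gH N : cint (fun t => f (z * e t) * H N t) = 0.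
  have hc (j k : 'I_N) : rcont (fun t : R => f (z * e t) * e t ^ (Posz j - Posz k)).
    by move=> t; apply: dcontM; [exact: gc|exact: powc].
  transitivity (cint (fun t : R =>
      \sum_(j < N) \sum_(k < N) f (z * e t) * e t ^ (Posz j - Posz k))).
    by apply: cint_eq => t; rewrite mulr_sumr; apply: eq_bigr => j _; rewrite mulr_sumr.
  rewrite cint_sum => [|j]; last by apply: rcont_sum => k; exact: hc.
  rewrite big1 // => j _; rewrite cint_sum => [|k]; last exact: hc.
  rewrite big1 // => k _.
  have zn0 : z ^ (Posz j - Posz k) != 0 by rewrite expfz_neq0.
  apply: (mulfI zn0); rewrite mulr0 -cintZ // -[RHS](f0 (Posz j - Posz k)).
  by apply: cint_eq => t; rewrite /= (expfzMl z) -[in RHS]mulrA; congr (_ * _); exact: mulrC.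
(* Near the peak [f] is within [cabs c / 2] of [c], elsewhere the contribution is at most [K]; the
   resulting inequality fails once [N] exceeds [2 * K / cabs c]. *)
have key N : cabs c * N%:R <= cabs c / 2 * N%:R + K.
  have -> : cabs c * N%:R = cabs (cint (fun t => (f (z * e t) - c) * H N t)).
    transitivity (cabs (cint (fun t => f (z * e t) * H N t + - c * H N t))).
      rewrite cintD; last 2 first.
      - by move=> t; apply: dcontM; [exact: gc|exact: Hc].
      - by move=> t; apply: dcontM; [exact: dcont_cst|exact: Hc].
      by rewrite gH add0r cintZ // HN cabsM cabsN cabs_nat.
    by congr cabs; apply: cint_eq => t; rewrite -mulrDl.
  have -> : cabs c / 2 * N%:R + K =
      complex.Re (cint (fun t => (cabs c / 2)%:C * H N t + K%:C)).
    have cH : rcont (fun t => (cabs c / 2)%:C * H N t).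
      by move=> t; apply: dcontM; [exact: dcont_cst|exact: Hc].
    rewrite cintD //; last by move=> t; exact: dcont_cst.
    rewrite cint_cst cintZ // HN.
    by rewrite -[N%:R in RHS](rmorph_nat (real_complex R)) -rmorphM -rmorphD.
  apply: cint_le.
  - move=> t; apply: dcontM; last exact: Hc.
    by apply: dcontB; [exact: gc|exact: dcont_cst].
  - move=> t; apply: dcontD; last exact: dcont_cst.
    by apply: dcontM; [exact: dcont_cst|exact: Hc].
  move=> t t01; rewrite cabsM HE -rmorphM -rmorphD /= cabsR.
  set D := cabs (\sum_(k < N) _); have D0 : 0 <= D by exact: cabs_ge0.
  rewrite ger0_norm ?exprn_ge0 //.
  have B0 : 0 <= B + cabs c by have := hB t t01; have := cabs_ge0 (f (z * e t)); lra.
  have D20 : 0 <= D ^+ 2 by rewrite exprn_ge0.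
  have [lt|ge] := ltrP (cabs (e t - 1)) eta.
    have K0 : 0 <= K by rewrite mulr_ge0 // exprn_ge0 // divr_ge0 // ltW.
    have h : cabs (f (z * e t) - c) < cabs c / 2.
      apply: hr; rewrite /cdist -{2}[z]mulr1 -mulrBr cabsM mulrC.
      by rewrite -ltr_pdivlMr.
    have := ler_wpM2r D20 (ltW h); lra.
  have hD : D <= 2 / eta.
    rewrite ler_pdivlMr //; apply: le_trans (geom_circle N t).
    by rewrite ler_wpM2l.
  have h1 : cabs (f (z * e t) - c) <= B + cabs c.
    by apply: le_trans (cabsD _ _) _; rewrite cabsN lerD2r hB.
  have h2 : D ^+ 2 <= (2 / eta) ^+ 2 by rewrite ler_pXn2r // nnegrE // divr_ge0 // ltW.
  have := ler_pM (cabs_ge0 _) D20 h1 h2; rewrite -/K.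
  by have : 0 <= cabs c / 2 * D ^+ 2 by [rewrite mulr_ge0 // divr_ge0 // ltW]; lra.
have K1 : 0 <= K / (cabs c / 2) + 1.
  have : 0 <= K by have := key 0%N; rewrite !mulr0 add0r.
  by move=> hK; rewrite addr_ge0 // divr_ge0 // divr_ge0 // ltW.
have := archi_boundP K1; set N := Num.bound _ => hN.
have := key N; have : K / (cabs c / 2) < N%:R by lra.
rewrite ltr_pdivrMr ?divr_gt0 //; lra.
Qed.

End CircleMeans.

(** * Theta functions *)

Section QPochhammer.
Variables (R : realType) (q : R[i]).
Hypotheses (q0 : q != 0) (q1 : cabs q < 1).
Implicit Types (z w : R[i]) (rho : R).

Let qa01 : 0 <= cabs q < 1.
Proof. by rewrite cabs_ge0. Qed.

Definition qpoch (N : nat) z : R[i] := \prod_(k < N) (1 - q ^+ k * z).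

Definition qpoch_inf z : R[i] := xget 0 (clim (fun N => qpoch N z)).

(** From 1 + x <= exp x in each factor and the sum of the geometric series with ratio |q|. *)
Definition qpoch_bound rho : R := expR (rho / (1 - cabs q)).

Lemma qpoch_le rho z N : cabs z <= rho -> cabs (qpoch N z) <= qpoch_bound rho.
Proof.
move=> hz; have rho0 : 0 <= rho := le_trans (cabs_ge0 _) hz.
have h1 : 0 < 1 - cabs q by rewrite subr_gt0.
suff : cabs (qpoch N z) <= expR (rho * (1 - cabs q ^+ N) / (1 - cabs q)).
  move=> /le_trans; apply; rewrite ler_expR ler_wpM2r ?invr_ge0 ?(ltW h1) //.
  by rewrite ler_piMr // gerBl exprn_ge0 // cabs_ge0.
rewrite /qpoch; elim: N => [|N IHN].
  by rewrite big_ord0 cabs1 expr0 subrr mulr0 mul0r expR0.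
rewrite big_ord_recr /= cabsM.
have -> : rho * (1 - cabs q ^+ N.+1) / (1 - cabs q) =
    rho * (1 - cabs q ^+ N) / (1 - cabs q) + cabs q ^+ N * rho.
  by rewrite exprSr; field; lra.
rewrite expRD ler_pM ?cabs_ge0 //; apply: le_trans (expR_ge1Dx _).
apply: le_trans (cabsD _ _) _; rewrite cabs1 cabsN cabsM cabsX lerD2l.
by rewrite ler_wpM2l // exprn_ge0 // cabs_ge0.
Qed.

(** The rate depends on [z] only through the bound [rho], so it is uniform on disks; continuity of
    the limit and approximation on circles both rest on this. *)
Lemma qpoch_cvg z : clim (fun N => qpoch N z) (qpoch_inf z) /\
  forall rho, cabs z <= rho -> forall N,
    cabs (qpoch N z - qpoch_inf z) <= qpoch_bound rho * rho / (1 - cabs q) * cabs q ^+ N.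
Proof.
have step rho : cabs z <= rho -> forall N,
    cabs (qpoch N.+1 z - qpoch N z) <= qpoch_bound rho * rho * cabs q ^+ N.
  move=> hz N; rewrite /qpoch big_ord_recr /= -/(qpoch N z).
  have -> : qpoch N z * (1 - q ^+ N * z) - qpoch N z = - (qpoch N z * (z * q ^+ N)) by ring.
  rewrite cabsN !cabsM cabsX mulrA ler_wpM2r ?exprn_ge0 ?cabs_ge0 //.
  by rewrite ler_pM ?cabs_ge0 // qpoch_le.
have [l hl _] := clim_geom qa01 (step _ (lexx _)).
have hinf : clim (fun N => qpoch N z) (qpoch_inf z) by exact: (xgetI 0 hl).
split=> // rho hz N; have [l' hl' e] := clim_geom qa01 (step _ hz).
by rewrite (clim_unique hinf hl').
Qed.

Lemma qpoch_inf_rec z : qpoch_inf z = (1 - z) * qpoch_inf (q * z).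
Proof.
have [h _] := qpoch_cvg z; have [h' _] := qpoch_cvg (q * z).
apply: (clim_unique (clim_shift h)); apply: clim_eq (climZ (1 - z) h') => N.
rewrite /qpoch big_ord_recl expr0 mul1r; congr (_ * _); apply: eq_bigr => k _.
by rewrite /= /bump /= exprS mulrA (mulrC q).
Qed.

Lemma qpoch_inf0 : qpoch_inf 0 = 1.
Proof.
have [h _] := qpoch_cvg 0; apply: (clim_unique h); apply: clim_eq (clim_cst 1) => N.
by rewrite /qpoch big1 // => k _; rewrite mulr0 subr0.
Qed.

Lemma qpoch_cdiff N z : cdiff (qpoch N) z.
Proof.
apply: (@cdiff_prod _ N (fun k w => 1 - q ^+ k * w)) => k.
apply: cdiffB; first exact: cdiff_cst.
by apply: cdiffM; [exact: cdiff_cst|exact: cdiff_id].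
Qed.

Lemma qpoch_inf_cont z : dcont (@cdist R) qpoch_inf z.
Proof.
move=> e e0; pose rho := cabs z + 1.
have [N hN] := @geom_lt R (qpoch_bound rho * rho / (1 - cabs q)) (e / 3) (cabs q) qa01 ltac:(lra).
have [r r0 hr] := cdiff_cont (qpoch_cdiff N z) (ltac:(lra) : 0 < e / 3).
exists (Num.min r 1); first by rewrite lt_min r0 ltr01.
move=> w; rewrite lt_min => /andP[wr w1].
have hz : cabs z <= rho by rewrite lerDl ler01.
have hw : cabs w <= rho by have := cabsB w z; rewrite /rho; move: w1; rewrite /cdist; lra.
have := (qpoch_cvg z).2 _ hz N; have := (qpoch_cvg w).2 _ hw N; have := hN _ (leqnn N).
have := hr _ wr; have := cabs_trans (qpoch N w) (qpoch_inf w) (qpoch_inf z).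
have := cabs_trans (qpoch N z) (qpoch N w) (qpoch_inf z).
rewrite (cabsC (qpoch_inf w) (qpoch N w)); lra.
Qed.

(** Peel off factors until [q ^+ N * z] is so close to 0 that the remaining product is nonzero; the
    zero then comes from one of the finitely many factors removed. *)
Lemma qpoch_inf_eq0 z : qpoch_inf z = 0 -> exists n : nat, q ^+ n * z = 1.
Proof.
move=> hz; apply: contrapT => hn.
have fac n : qpoch_inf z = qpoch n z * qpoch_inf (q ^+ n * z).
  elim: n => [|n ->]; first by rewrite /qpoch big_ord0 !mul1r.
  by rewrite /qpoch big_ord_recr /= -mulrA qpoch_inf_rec mulrA -exprS.
have [r r0 hr] := dcont_neq0 (@qpoch_inf_cont 0) ltac:(by rewrite qpoch_inf0 oner_neq0).
have [N hN] := geom_lt (cabs z) qa01 r0.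
have := hr (q ^+ N * z); rewrite /cdist subr0 cabsM cabsX mulrC => /(_ (hN _ (leqnn _))).
have := fac N; rewrite hz => /esym/eqP; rewrite mulf_eq0 => /orP[|->//].
rewrite prodf_seq_eq0 => /hasP[k _ /=]; rewrite subr_eq0 eq_sym => /eqP h; case: hn.
by exists k.
Qed.

Lemma qpoch_inf_root z (n : nat) : q ^+ n * z = 1 -> qpoch_inf z = 0.
Proof.
elim: n z => [|n IHn] z; rewrite qpoch_inf_rec.
  by rewrite mul1r => ->; rewrite subrr mul0r.
by rewrite exprSr -mulrA => /IHn ->; rewrite mulr0.
Qed.

(** Jacobi's theta function in product form, without the constant factor (q; q)_infinity. *)
Definition theta z : R[i] := qpoch_inf z * qpoch_inf (q / z).

Lemma theta_qshift z : z != 0 -> theta (q * z) = - z^-1 * theta z.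
Proof.
move=> z0; rewrite /theta (qpoch_inf_rec z) invfM mulrA divff // mul1r.
by rewrite (qpoch_inf_rec z^-1); field.
Qed.

Lemma theta_eq0 z : z != 0 -> theta z = 0 <-> exists n : int, z = q ^ n.
Proof.
move=> z0; split=> [/eqP|[[n|n] ->]].
- rewrite mulf_eq0 => /orP[] /eqP/qpoch_inf_eq0[n hn].
    exists (- Posz n); rewrite -exprnN -[LHS](mulKf (_ : q ^+ n != 0)) ?expf_neq0 //.
    by rewrite hn mulr1.
  exists (Posz n.+1); rewrite -[LHS]mul1r -hn mulrA mulfVK // -exprSr //.
- case: n => [|n].
    by rewrite /theta (@qpoch_inf_root _ 0) ?mul0r // mul1r.
  rewrite /theta (@qpoch_inf_root (q / q ^ n.+1) n) ?mulr0 // mulrA -exprSr.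
  by rewrite divff // expf_neq0.
rewrite /theta (@qpoch_inf_root _ n.+1) ?mul0r // NegzE -exprnN.
by rewrite divff // expf_neq0.
Qed.

(** Uniformity on each circle suffices to pass to the limit in circle means; the common bound is
    what makes the notion stable under products. *)
Definition circle_approx (F : nat -> R[i] -> R[i]) f := forall z, z != 0 ->
  (exists B : R, forall N w, cabs w = cabs z -> cabs (F N w) <= B /\ cabs (f w) <= B) /\
  (forall e : R, 0 < e -> exists N0, forall N w, (N0 <= N)%N -> cabs w = cabs z ->
     cabs (F N w - f w) <= e).

Lemma circle_approxM F f G g : circle_approx F f -> circle_approx G g ->
  circle_approx (fun N w => F N w * G N w) (fun w => f w * g w).
Proof.
move=> hF hG z z0; have [[B hB] cF] := hF z z0; have [[C hC] cG] := hG z z0.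
have [B0 _] := hB 0%N z erefl; have [C0 _] := hC 0%N z erefl.
have {}B0 := le_trans (cabs_ge0 _) B0; have {}C0 := le_trans (cabs_ge0 _) C0.
split.
  exists (B * C) => N w wz; have [b1 b2] := hB N w wz; have [c1 c2] := hC N w wz.
  by rewrite !cabsM !ler_pM ?cabs_ge0.
move=> e e0; have k0 : 0 < 1 + B + C by lra.
have [N0 hN0] := cF (e / (1 + B + C)) (divr_gt0 e0 k0).
have [N1 hN1] := cG (e / (1 + B + C)) (divr_gt0 e0 k0).
exists (maxn N0 N1) => N w; rewrite geq_max => /andP[/hN0 h0 /hN1 h1] wz.
have [b1 b2] := hB N w wz; have [c1 c2] := hC N w wz.
have -> : F N w * G N w - f w * g w = (F N w - f w) * G N w + f w * (G N w - g w) by ring.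
apply: le_trans (cabsD _ _) _; rewrite !cabsM.
have := ler_pM (cabs_ge0 _) (cabs_ge0 _) (h0 _ wz) c1.
have := ler_pM (cabs_ge0 _) (cabs_ge0 _) b2 (h1 _ wz).
have : 0 <= e / (1 + B + C) by rewrite divr_ge0 // ltW.
have : e / (1 + B + C) * (1 + B + C) = e by rewrite mulfVK // gt_eqF.
set d := e / _ => <-; nra.
Qed.

Lemma circle_approx_qpoch (a : R[i] -> R[i]) :
  (forall z w, cabs w = cabs z -> cabs (a w) = cabs (a z)) ->
  circle_approx (fun N w => qpoch N (a w)) (fun w => qpoch_inf (a w)).
Proof.
move=> ha z z0; set rho := cabs (a z).
have aw w : cabs w = cabs z -> cabs (a w) <= rho by move=> /ha ->.
split.
  exists (qpoch_bound rho) => N w /aw wz; split; first exact: qpoch_le.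
  have [h _] := qpoch_cvg (a w).
  by apply: (cabs_clim h) => M; exact: qpoch_le.
move=> e e0.
have [N0 hN0] := geom_lt (qpoch_bound rho * rho / (1 - cabs q)) qa01 e0.
exists N0 => N w NN /aw wz; have [_ /(_ _ wz N) h] := qpoch_cvg (a w).
exact: le_trans h (ltW (hN0 _ NN)).
Qed.

Lemma laurent_approx F f : (forall N, laurent (F N)) -> cont_Cstar f ->
  circle_approx F f -> laurent f.
Proof.
move=> hF fc hf; split=> // n z w z0 w0.
have near u (e : R) : u != 0 -> 0 < e -> exists N0, forall N, (N0 <= N)%N ->
    cabs (laurent_coef (F N) n u - laurent_coef f n u) <= e.
  move=> u0 e0; have [_ cf] := hf u u0.
  have p0 : 0 < cabs (u ^ n) by rewrite cabs_gt0 expfz_neq0.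
  have [N0 hN0] := cf (e / cabs (u ^ n)) (divr_gt0 e0 p0).
  exists N0 => N NN; have [Fc _] := hF N.
  rewrite -[- laurent_coef f n u]mulN1r -laurent_coefZ // -laurent_coefD //; last first.
    by move=> v v0; apply: dcontM; [exact: dcont_cst|exact: fc].
  apply: cint_bound.
    apply: (rcont_circle u0 (f := fun w => w ^ n * (F N w + -1 * f w))).
    apply: cont_coef => v v0; apply: dcontD; first exact: Fc.
    by apply: dcontM; [exact: dcont_cst|exact: fc].
  move=> t _ /=; set v := u * _.
  have vu : cabs v = cabs u by rewrite cabsM cabs_circle mulr1.
  rewrite cabsM cabsXz vu -cabsXz mulN1r mulrC -ler_pdivlMr //; exact: hN0.
apply/eqP; rewrite -subr_eq0; apply/eqP/cabs_small => e e0.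
have [N0 h0] := near z (e / 2) z0 ltac:(lra); have [N1 h1] := near w (e / 2) w0 ltac:(lra).
have := h0 (maxn N0 N1) (leq_maxl _ _); have := h1 (maxn N0 N1) (leq_maxr _ _).
rewrite ((hF _).2 n z w z0 w0); set x := laurent_coef (F _) n _.
have := cabs_trans x (laurent_coef f n z) (laurent_coef f n w).
rewrite (cabsC (laurent_coef f n z) x); lra.
Qed.

End QPochhammer.

(** * The equation f(qz) = c z^-2 f(z) and its zeros *)

Section ThetaDegreeTwo.
Variables (R : realType) (q : R[i]).
Hypotheses (q0 : q != 0) (q1 : cabs q < 1).
Implicit Types (z w c s : R[i]) (f : R[i] -> R[i]).

Lemma q_equiv_sym z w : q_equiv q z w -> q_equiv q w z.
Proof. by move=> [n hn]; exists (- n); rewrite -invr_expz -hn invf_div. Qed.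

Lemma q_equiv_trans z w u : w != 0 -> q_equiv q z w -> q_equiv q w u -> q_equiv q z u.
Proof.
move=> w0 [m hm] [n hn]; exists (m + n); rewrite expfzDr // -hm -hn.
by rewrite mulrA mulfVK.
Qed.

Definition theta2_mult c f := forall z, z != 0 -> f (q * z) = c * z ^- 2 * f z.

(** The coefficient is computed on the circle through [q * z] instead of [z], and the functional
    equation brings it back. The result is a two-step recursion, so the coefficients of index 0 and
    1 determine all others. *)
Lemma theta2_coef c f n z : laurent f -> theta2_mult c f -> z != 0 ->
  laurent_coef f n z = q ^ n * c * laurent_coef f (n - 2) z.
Proof.
move=> [fc fl] fq z0; have qz0 : q * z != 0 by rewrite mulf_neq0.
rewrite (fl n z (q * z)) // -cintZ; last first.
  by apply: (rcont_circle z0 (f := fun w => w ^ (n - 2) * f w)); exact: cont_coef.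
apply: cint_eq => t; rewrite -mulrA; set u := z * _.
have u0 : u != 0 by exact: circle_neq0.
rewrite /= fq // expfzMl expfzDr // (_ : u ^ (-2) = u ^- 2) //.
by rewrite -!mulrA; congr (_ * _); rewrite mulrCA; congr (_ * _).
Qed.

Lemma theta2_eq0 c f : c != 0 -> laurent f -> theta2_mult c f ->
  laurent_coef f 0 1 = 0 -> laurent_coef f 1 1 = 0 -> forall z, z != 0 -> f z = 0.
Proof.
move=> c0 fl fq h0 h1; have u1 : (1 : R[i]) != 0 := oner_neq0 _.
have up n : laurent_coef f n 1 = 0 -> laurent_coef f (n + 2) 1 = 0.
  by move=> hn; rewrite (theta2_coef _ fl fq) // addrK hn mulr0.
have down n : laurent_coef f n 1 = 0 -> laurent_coef f (n - 2) 1 = 0.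
  rewrite (theta2_coef _ fl fq) // => /eqP; rewrite !mulf_eq0.
  by rewrite (negPf (expfz_neq0 _ q0)) (negPf c0) /= => /eqP.
(* Carrying four indices lets a single induction run upwards and downwards through both parities. *)
have both (k : nat) : [/\ laurent_coef f (Posz k) 1 = 0, laurent_coef f (Posz k + 1) 1 = 0,
    laurent_coef f (- Posz k) 1 = 0 & laurent_coef f (1 - Posz k) 1 = 0].
  elim: k => [|k [k1 k2 k3 k4]]; first by rewrite add0r oppr0 subr0.
  split.
  - by rewrite -addn1 PoszD.
  - by rewrite (_ : k.+1%:Z + 1 = k%:Z + 2); [exact: up|lia].
  - by rewrite (_ : - k.+1%:Z = 1 - k%:Z - 2); [exact: down|lia].
  - by rewrite (_ : 1 - k.+1%:Z = - k%:Z); [|lia].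
have all n : laurent_coef f n 1 = 0.
  case: n => k; first by have [h _ _ _] := both k.
  by rewrite NegzE; have [_ _ h _] := both k.+1.
move=> z z0; apply: laurent_coef_inj => //; first exact: fl.1.
by move=> n; rewrite (fl.2 n z 1).
Qed.

Lemma theta2_dependent c (F : 'I_3 -> R[i] -> R[i]) : c != 0 ->
  (forall i, laurent (F i)) -> (forall i, theta2_mult c (F i)) ->
  exists2 a : 'I_3 -> R[i], exists i, a i != 0 &
    forall z, z != 0 -> \sum_i a i * F i z = 0.
Proof.
move=> c0 Fl Fq; have u1 : (1 : R[i]) != 0 := oner_neq0 _.
pose A : 'M[R[i]]_(3, 2) := \matrix_(i, j) laurent_coef (F i) (Posz j) 1.
have : kermx A != 0.
  by rewrite kermx_eq0 /row_free; have := rank_leq_col A; lia.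
case/rowV0Pn => v /sub_kermxP vA v0.
have [i vi] : exists i, v 0 i != 0.
  apply: contrapT => h; move/eqP: v0; apply; apply/rowP => i; rewrite mxE.
  by apply/eqP; apply: contraT => vi; case: h; exists i.
exists (fun i => v 0 i); first by exists i.
have sl n (G : 'I_n -> R[i] -> R[i]) (a : 'I_n -> R[i]) : (forall i, laurent (G i)) ->
    laurent (fun z => \sum_i a i * G i z) /\
    forall m, laurent_coef (fun z => \sum_i a i * G i z) m 1 =
      \sum_i a i * laurent_coef (G i) m 1.
  elim: n G a => [|n IHn] G a hG.
    have E : (fun z => \sum_(i < 0) a i * G i z) = (fun=> 0) by apply/funext => z; rewrite big_ord0.
    rewrite E; split=> [|m]; first by apply: holo_laurent => z _; exact: cdiff_cst.
    by rewrite big_ord0 -[RHS](cint_cst 0); apply: cint_eq => t; rewrite mulr0.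
  have E : (fun z => \sum_(i < n.+1) a i * G i z) =
      (fun z => a ord0 * G ord0 z + \sum_(i < n) a (lift ord0 i) * G (lift ord0 i) z).
    by apply/funext => z; rewrite big_ord_recl.
  have [l1 l2] := IHn (fun i => G (lift ord0 i)) (fun i => a (lift ord0 i)) (fun i => hG _).
  have l0 := laurentZ (a ord0) (hG ord0).
  rewrite E; split=> [|m]; first exact: laurentD.
  rewrite big_ord_recl laurent_coefD ?laurent_coefZ ?l2 //;
    [exact: (hG _).1|exact: l0.1|exact: l1.1].
have [gl gc] := sl _ F (fun i => v 0 i) Fl.
have gv j : laurent_coef (fun z => \sum_i v 0 i * F i z) (Posz (j : 'I_2)) 1 = 0.
  rewrite gc; transitivity ((v *m A) 0 j); last by rewrite vA mxE.
  by rewrite mxE; apply: eq_bigr => k _; rewrite mxE.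
apply: (theta2_eq0 c0 gl) => [z z0||]; last 2 first.
- exact: (gv ord0).
- exact: (gv ord_max).
by rewrite mulr_sumr; apply: eq_bigr => k _; rewrite Fq // mulrCA.
Qed.

(** The solution with a prescribed zero [s]. The multiplier [c] fixes the other factor: the second
    zero is [c / s], up to powers of q. *)
Definition theta2 c s z : R[i] := theta q (z / s) * theta q (z * s / c).

Lemma theta2_laurent c s : c != 0 -> s != 0 -> laurent (theta2 c s).
Proof.
move=> c0 s0.
have id0 z : z != 0 -> z / s != 0 /\ z * s / c != 0.
  by move=> z0; rewrite !mulf_neq0 ?invr_eq0.
apply: (@laurent_approx _ (fun N z => (qpoch q N (z / s) * qpoch q N (q / (z / s))) *
   (qpoch q N (z * s / c) * qpoch q N (q / (z * s / c))))).
- move=> N; apply: holo_laurent => z z0; have [h1 h2] := id0 z z0.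
  have d1 : cdiff (fun z => z / s) z by apply: cdiffM; [exact: cdiff_id|exact: cdiff_cst].
  have d2 : cdiff (fun z => z * s / c) z.
    by apply: cdiffM; [apply: cdiffM; [exact: cdiff_id|exact: cdiff_cst]|exact: cdiff_cst].
  have dq a : cdiff a z -> cdiff (fun z => qpoch q N (a z)) z.
    by move=> ha; apply: cdiff_comp => //; exact: qpoch_cdiff.
  by apply: cdiffM; apply: cdiffM; apply: dq => //; apply: cdiffM;
    [exact: cdiff_cst|exact: cdiffV|exact: cdiff_cst|exact: cdiffV].
- move=> z z0; have [h1 h2] := id0 z z0.
  have d1 : dcont (@cdist R) (fun z => z / s) z by apply: dcontM; [exact: dcont_id|exact: dcont_cst].
  have d2 : dcont (@cdist R) (fun z => z * s / c) z.
    by apply: dcontM; [apply: dcontM; [exact: dcont_id|exact: dcont_cst]|exact: dcont_cst].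
  have dq a : dcont (@cdist R) a z -> dcont (@cdist R) (fun z => qpoch_inf q (a z)) z.
    by move=> ha; apply: dcont_comp => //; exact: qpoch_inf_cont.
  by apply: dcontM; apply: dcontM; apply: dq => //; apply: dcontM;
    [exact: dcont_cst|exact: dcontV|exact: dcont_cst|exact: dcontV].
apply: circle_approxM; apply: circle_approxM; apply: circle_approx_qpoch => // z w wz;
  by rewrite !(cabsM, cabsV) wz.
Qed.

Lemma theta2_qshift c s : c != 0 -> s != 0 -> theta2_mult c (theta2 c s).
Proof.
move=> c0 s0 z z0; rewrite /theta2.
have -> : q * z / s = q * (z / s) by rewrite mulrA.
have -> : q * z * s / c = q * (z * s / c) by rewrite !mulrA.
rewrite !theta_qshift ?mulf_neq0 ?invr_eq0 //.
by field; rewrite z0 c0 s0.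
Qed.

Lemma theta2_root c s : s != 0 -> theta2 c s s = 0.
Proof.
move=> s0; rewrite /theta2 divff // (theta_eq0 q0 q1 (oner_neq0 _)).2 ?mul0r //.
by exists 0.
Qed.

Lemma theta2_neq0 c s z : c != 0 -> s != 0 -> z != 0 -> ~ q_equiv q z s ->
  ~ q_equiv q (z * s) c -> theta2 c s z != 0.
Proof.
move=> c0 s0 z0 h1 h2; rewrite mulf_eq0; apply/norP; split; apply/eqP.
  by move/(theta_eq0 q0 q1); rewrite mulf_neq0 ?invr_eq0 // => /(_ isT).
by move/(theta_eq0 q0 q1); rewrite !mulf_neq0 ?invr_eq0 // => /(_ isT).
Qed.

(** [f], [theta2 c a] and [theta2 c b] are linearly dependent. Evaluating the relation at [a]
    isolates the third term and at [b] the second, and the hypotheses on [a], [b] and [a * b] make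
    those theta values nonzero; so only the term in [f] survives. *)
Lemma theta2_two_zeros c f a b : c != 0 -> a != 0 -> b != 0 -> laurent f -> theta2_mult c f ->
  ~ q_equiv q a b -> ~ q_equiv q (a * b) c -> f a = 0 -> f b = 0 ->
  forall z, z != 0 -> f z = 0.
Proof.
move=> c0 a0 b0 fl fq ab abc fa fb z z0.
pose F (i : 'I_3) : R[i] -> R[i] :=
  if i == 0 then f else if i == 1 then theta2 c a else theta2 c b.
have [|| al [i ali] hal] := @theta2_dependent c F c0.
- move=> i; rewrite /F; case: (i == 0); first exact: fl.
  by case: (i == 1); exact: theta2_laurent.
- move=> i; rewrite /F; case: (i == 0); first exact: fq.
  by case: (i == 1); exact: theta2_qshift.
have E w : w != 0 -> al 0 * f w + al 1 * theta2 c a w + al ord_max * theta2 c b w = 0.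
  move=> w0; rewrite -[RHS](hal w w0) !big_ord_recl big_ord0 addr0 addrA /F /=.
  by congr (_ + al _ * _ + al _ * _); apply/val_inj.
have nab : theta2 c b a != 0 by exact: theta2_neq0.
have nba : theta2 c a b != 0.
  by apply: theta2_neq0; rewrite // 1?mulrC // => /q_equiv_sym.
have al2 : al ord_max = 0.
  have := E a a0; rewrite fa theta2_root // !mulr0 !add0r => /eqP.
  by rewrite mulf_eq0 (negPf nab) orbF => /eqP.
have al1 : al 1 = 0.
  have := E b b0; rewrite fb theta2_root // !mulr0 add0r addr0 => /eqP.
  by rewrite mulf_eq0 (negPf nba) orbF => /eqP.
have al0 : al 0 != 0.
  apply: contraNneq ali => al0; suff : i \in [:: 0; 1; ord_max].
    by rewrite !inE => /or3P[] /eqP ->; rewrite ?al0 ?al1 ?al2.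
  by case: i => -[|[|[|]]].
have := E z z0; rewrite al1 al2 !mul0r !addr0 => /eqP.
by rewrite mulf_eq0 (negPf al0) => /eqP.
Qed.

(** If [a * b] and [a * d] were both equivalent to [c], then [b] and [d] would be equivalent; hence
    one of the two pairs is covered by the case of two zeros. *)
Lemma theta2_three_zeros c f a b d : c != 0 -> a != 0 -> b != 0 -> d != 0 ->
  laurent f -> theta2_mult c f ->
  ~ q_equiv q a b -> ~ q_equiv q a d -> ~ q_equiv q b d -> f a = 0 -> f b = 0 -> f d = 0 ->
  forall z, z != 0 -> f z = 0.
Proof.
move=> c0 a0 b0 d0 fl fq ab ad bd fa fb fd.
have [[m hm]|abc] := pselect (q_equiv q (a * b) c); last exact: (theta2_two_zeros c0 a0 b0).
have [[n hn]|adc] := pselect (q_equiv q (a * d) c); last exact: (theta2_two_zeros c0 a0 d0).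
case: bd; exists (m - n); rewrite expfzDr // -invr_expz -hm -hn.
by field; rewrite a0 c0 d0.
Qed.

(* A ball contains three points that are pairwise inequivalent modulo powers of q. *)
Lemma theta2_dense c f g : c != 0 -> laurent f -> theta2_mult c f ->
  (exists2 z, z != 0 & f z != 0) -> cont_Cstar g ->
  (forall z, z != 0 -> f z != 0 -> g z = 0) -> forall z, z != 0 -> g z = 0.
Proof.
move=> c0 fl fq [y y0 fy] gc fg z z0; apply/eqP; apply: contraT => gz.
have [r r0 hr] := dcont_neq0 (gc z z0) gz.
have zc0 : 0 < cabs z by rewrite cabs_gt0.
have qc0 : 0 < cabs q by rewrite cabs_gt0.
(* The points used are z (1 + t) with t = 0, e/3, e/2. The first bound keeps them within [r] of [z];
   the second keeps the ratios of their moduli strictly between 1 and 1/|q|, where no power of |q|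
   lies. *)
pose e := Num.min (r / (2 * cabs z)) ((cabs q)^-1 - 1).
have iq : 1 < (cabs q)^-1 by rewrite invf_gt1.
have e0 : 0 < e by rewrite lt_min subr_gt0 iq divr_gt0 // mulr_gt0.
have er : e * cabs z < r.
  have : e <= r / (2 * cabs z) by rewrite ge_min lexx.
  rewrite ler_pdivlMr ?mulr_gt0 //; nra.
have eq : 1 + e <= (cabs q)^-1.
  have : e <= (cabs q)^-1 - 1 by rewrite ge_min lexx orbT.
  lra.
clearbody e.
pose p (t : R) : R[i] := z * (1 + t)%:C.
have p0 (t : R) : 0 <= t -> p t != 0.
  by move=> t0; rewrite mulf_neq0 // -cabs_gt0 cabsR normr_gt0; lra.
have fp (t : R) : 0 <= t <= e -> f (p t) = 0.
  move=> /andP[t0 te]; apply/eqP; apply: contraT => /(fg _ (p0 t t0)) h.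
  have := hr (p t); rewrite h eqxx; apply; rewrite /cdist /p.
  rewrite rmorphD rmorph1 mulrDr mulr1 addrC addKr cabsM cabsR ger0_norm //; nra.
have pq (s t : R) : 0 <= s -> s < t -> t < e -> ~ q_equiv q (p t) (p s).
  move=> s0 st te [n hn]; have : cabs (p t / p s) = cabs q ^ n by rewrite hn cabsXz.
  rewrite /p -mulf_div divff // mul1r cabsM cabsV !cabsR !ger0_norm; try lra.
  move=> h; have s1 : 0 < 1 + s by lra.
  have h1 : 1 < cabs q ^ n by rewrite -h ltr_pdivlMr // mul1r; lra.
  have h2 : cabs q ^ n < (cabs q)^-1.
    by rewrite -h ltr_pdivrMr //; have : 0 < (cabs q)^-1 * s + ((cabs q)^-1 - (1 + t)); [|nra]; nra.
  have hn' : cabs q ^ n = (cabs q)^-1 ^ (- n) by rewrite exprz_inv opprK.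
  have n1 : (cabs q)^-1 ^ (0 : int) < (cabs q)^-1 ^ (- n) by rewrite expr0z -hn'.
  have n2 : (cabs q)^-1 ^ (- n) < (cabs q)^-1 ^ (1 : int) by rewrite expr1z -hn'.
  move: n1 n2; rewrite !ltr_eXz2l // gtz0_ge1 => n1 /(le_lt_trans n1).
  by rewrite ltxx.
suff : f y = 0 by move/eqP; rewrite (negPf fy).
apply: (@theta2_three_zeros c f (p (e / 2)) (p (e / 3)) (p 0)) => //; try (apply: p0; lra);
  try (apply: pq; lra); apply: fp; apply/andP; split; lra.
Qed.

End ThetaDegreeTwo.

(** * Mano factors *)

Section TwoByTwo.
Variable R : realType.
Implicit Types (a b c d : R[i]) (A B : 'M[R[i]]_2) (F G : R[i] -> 'M[R[i]]_2).

Lemma mx2_eta A : A = mx2 (A 0 0) (A 0 1) (A 1 0) (A 1 1).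
Proof.
apply/matrixP => i j; rewrite mxE.
by case: i j => -[|[|i]] hi // [[|[|j]] hj] //=; congr (A _ _); apply/val_inj.
Qed.

Lemma mx2M a b c d a' b' c' d' : mx2 a b c d *m mx2 a' b' c' d' =
  mx2 (a * a' + b * c') (a * b' + b * d') (c * a' + d * c') (c * b' + d * d').
Proof.
apply/matrixP => i j; rewrite !mxE !big_ord_recl big_ord0 !mxE addr0 /=.
by case: i j => -[|[|i]] hi // [[|[|j]] hj].
Qed.

Lemma mx2_1 : mx2 1 0 0 1 = 1%:M :> 'M[R[i]]_2.
Proof. by apply/matrixP => i j; rewrite !mxE; case: i j => -[|[|i]] hi // [[|[|j]] hj]. Qed.

Lemma mx2_inj a b c d a' b' c' d' : mx2 a b c d = mx2 a' b' c' d' ->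
  [/\ a = a', b = b', c = c' & d = d'].
Proof.
by move=> /matrixP h; split; [have := h 0 0|have := h 0 1|have := h 1 0|have := h 1 1]; rewrite !mxE.
Qed.

Lemma det_mx2 A : \det A = A 0 0 * A 1 1 - A 0 1 * A 1 0.
Proof.
rewrite (expand_det_row A 0) !big_ord_recl big_ord0 addr0 /cofactor !det_mx11 !mxE /=.
rewrite expr0 mul1r expr1 mulN1r mulrN.
by congr (A _ _ * A _ _ - A _ _ * A _ _); apply/val_inj.
Qed.

Lemma det_mx2E a b c d : \det (mx2 a b c d) = a * d - b * c.
Proof. by rewrite det_mx2 !mxE. Qed.

Definition cdiff_mx F z := forall i j, cdiff (fun w => F w i j) z.

Lemma holomorphic_mxE F : holomorphic_mx F <-> forall z, z != 0 -> cdiff_mx F z.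
Proof.
split=> [h z z0 i j|h i j]; first by have /holomorphicE := h i j; exact.
by apply/holomorphicE => z z0; exact: h.
Qed.

Lemma cdiff_mulmx F G z : cdiff_mx F z -> cdiff_mx G z -> cdiff_mx (fun w => F w *m G w) z.
Proof.
move=> hF hG i j; apply: (@cdiff_eq _ (fun w => F w i 0 * G w 0 j + F w i 1 * G w 1 j)).
  move=> w; rewrite mxE !big_ord_recl big_ord0 addr0.
  by congr (_ + F w _ _ * G w _ _); apply/val_inj.
by apply: cdiffD; apply: cdiffM.
Qed.

Lemma cdiff_cstmx A z : cdiff_mx (fun=> A) z.
Proof. by move=> i j; exact: cdiff_cst. Qed.

Lemma cdiff_det F z : cdiff_mx F z -> cdiff (fun w => \det (F w)) z.
Proof.
move=> hF; apply: (@cdiff_eq _ (fun w => F w 0 0 * F w 1 1 - F w 0 1 * F w 1 0)).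
  by move=> w; rewrite det_mx2.
by apply: cdiffB; apply: cdiffM.
Qed.

Lemma cdiff_near_mx F G z (r : R) : 0 < r ->
  (forall w, cabs (w - z) < r -> F w = G w) -> cdiff_mx F z -> cdiff_mx G z.
Proof.
move=> r0 FG hF i j; apply: (cdiff_near r0 _ (hF i j)) => w /FG -> //.
Qed.

Lemma cdiff_invmx F z : cdiff_mx F z -> \det (F z) != 0 -> cdiff_mx (fun w => invmx (F w)) z.
Proof.
move=> hF dz; have dc := cdiff_det hF.
have [r r0 hr] := dcont_neq0 (cdiff_cont dc) dz.
apply: (@cdiff_near_mx (fun w => (\det (F w))^-1 *: \adj (F w)) _ _ r) => //.
  by move=> w /hr h; rewrite /invmx unitmxE unitfE h.
move=> i j; apply: (@cdiff_eq _ (fun w => (\det (F w))^-1 * ((-1) ^+ (j + i) * F w (lift j 0) (lift i 0)))).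
  by move=> w; rewrite !mxE /cofactor det_mx11 !mxE.
by apply: cdiffM; [exact: cdiffV|apply: cdiffM; [exact: cdiff_cst|exact: hF]].
Qed.

End TwoByTwo.

(** The algebra behind L(qz) C = C' L(z) for L = P'^-1 P: [X] and [X'] stand for P and P' at z, and
    [Y'] for P' at qz. *)
Lemma intertwine_quotient (F : fieldType) n (A C C' X X' Y' : 'M[F]_n) (z : F) :
  X' \in unitmx -> C \in unitmx -> C' \in unitmx -> z != 0 -> Y' \in unitmx ->
  Y' = A *m X' *m invmx (z *: C') ->
  invmx Y' *m (A *m X *m invmx (z *: C)) *m C = C' *m (invmx X' *m X).
Proof.
move=> Xu Cu Cu' z0 Yu YE; have zu : z \is a GRing.unit by rewrite unitfE.
have -> : A *m X *m invmx (z *: C) = Y' *m (C' *m (invmx X' *m X) *m invmx C).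
  rewrite YE !invmxZ ?unitmxZ // -!scalemxAr -!scalemxAl; congr (_ *: _).
  by rewrite !mulmxA mulmxKV // mulmxK.
by rewrite mulKmx // mulmxKV.
Qed.

(** The algebra behind the change of factor: with [L], [L1] the values of the gauge at z and qz and
    [L'], [L1'] their inverses, P L^-1 solves the equation with [C']. *)
Lemma intertwine_inverse (F : fieldType) n (A C C' X L L1 L1' L' : 'M[F]_n) (z : F) :
  C \in unitmx -> C' \in unitmx -> z != 0 -> L *m L' = 1%:M -> L1 *m L1' = 1%:M ->
  L1 *m C = C' *m L -> A *m X *m invmx (z *: C) *m L1' = A *m (X *m L') *m invmx (z *: C').
Proof.
move=> Cu Cu' z0 LL LL1 LC; have zu : z \is a GRing.unit by rewrite unitfE.
rewrite !invmxZ ?unitmxZ // -!scalemxAr -!scalemxAl; congr (_ *: _).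
have [L1u _] := mulmx1_unit LL1; rewrite -!mulmxA; congr (A *m (X *m _)).
apply: (can_inj (mulKmx Cu)); rewrite mulKVmx //.
apply: (can_inj (mulKmx L1u)); rewrite LL1 !mulmxA LC -(mulmxA C') LL.
by rewrite mulmx1 mulmxV.
Qed.

Section ManoFactors.
Variables (R : realType) (q : R[i]).
Hypotheses (q0 : q != 0) (q1 : cabs q < 1).
Implicit Types (C : 'M[R[i]]_2) (P Q : R[i] -> 'M[R[i]]_2).

Section Gauge.
Variables (A B : 'M[R[i]]_2) (x : 'I_4 -> R[i]) (M : R[i] -> 'M[R[i]]_2).
Hypotheses (Au : A \in unitmx) (Bu : B \in unitmx) (x0 : forall k, x k != 0).
Hypothesis xNR : forall k l : 'I_4, (k < l)%N -> ~ q_equiv q (x k) (x l).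
Hypothesis MF : in_F q A B x M.

Let dA : \det A != 0. Proof. by rewrite -unitfE -unitmxE. Qed.
Let dB : \det B != 0. Proof. by rewrite -unitfE -unitmxE. Qed.

Lemma det_inv_scale (z : R[i]) (C : 'M[R[i]]_2) : z != 0 -> C \in unitmx ->
  \det (invmx (z *: C)) = (z ^+ 2 * \det C)^-1.
Proof. by move=> z0 Cu; rewrite det_inv detZ. Qed.

Let i2 : 'I_4 := Ordinal (isT : 2 < 4)%N.
Let i3 : 'I_4 := Ordinal (isT : 3 < 4)%N.

Lemma mano_det_zeros C P Q : mano_decomposition q A x M C P Q ->
  [/\ \det C != 0,
      theta2_mult q (\det A / \det C) (fun z => \det (P z)),
      exists2 z, z != 0 & \det (P z) != 0,
      forall z, z != 0 -> \det (P z) = 0 -> q_equiv q z (x 0) \/ q_equiv q z (x 1) &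
      forall z, z != 0 -> \det (Q z) = 0 -> q_equiv q z (x i2) \/ q_equiv q z (x i3)].
Proof.
move=> [[/holomorphic_mxE Ph /holomorphic_mxE Qh] Cu MPQ Pq [P0 P1]].
have [/holomorphic_mxE Mh Mq [y y0 My] Mx] := MF.
have dC : \det C != 0 by rewrite -unitfE -unitmxE.
have Pm : theta2_mult q (\det A / \det C) (fun z => \det (P z)).
  move=> z z0; rewrite Pq // !det_mulmx det_inv_scale //.
  by field; rewrite z0 dC.
have [dPy dQy] : \det (P y) != 0 /\ \det (Q y) != 0.
  by move: My; rewrite MPQ // det_mulmx mulf_eq0 => /norP.
have cP : \det A / \det C != 0 by rewrite mulf_neq0 ?invr_eq0.
have Pd z : z != 0 -> cdiff (fun z => \det (P z)) z by move=> z0; exact/cdiff_det/Ph.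
have Qd z : z != 0 -> cdiff (fun z => \det (Q z)) z by move=> z0; exact/cdiff_det/Qh.
have Pl : laurent (fun z => \det (P z)) by exact: holo_laurent.
have Ql : laurent (fun z => \det (Q z)) by exact: holo_laurent.
have zeros (f : R[i] -> R[i]) c a b : c != 0 -> laurent f -> theta2_mult q c f -> f y != 0 ->
    a != 0 -> b != 0 -> ~ q_equiv q a b -> f a = 0 -> f b = 0 ->
    forall z, z != 0 -> f z = 0 -> q_equiv q z a \/ q_equiv q z b.
  move=> c0 fl fm fy a0 b0 ab fa fb z z0 fz; apply: contrapT => /not_orP[za zb].
  have := @theta2_three_zeros _ q q0 q1 c f a b z c0 a0 b0 z0 fl fm ab.
  move=> /(_ (fun h => za (q_equiv_sym h)) (fun h => zb (q_equiv_sym h)) fa fb fz y y0) h.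
  by rewrite h eqxx in fy.
have Pz := zeros _ _ (x 0) (x 1) cP Pl Pm dPy (x0 _) (x0 _) (@xNR 0 1 isT) P0 P1.
(* The equation of det Q is that of det M divided by that of det P, hence known only where det P is
   nonzero; [theta2_dense] extends it. *)
have Qm : theta2_mult q (\det C / \det B) (fun z => \det (Q z)).
  move=> z z0; apply/eqP; rewrite -subr_eq0; apply/eqP; move: z z0.
  apply: (theta2_dense q0 q1 cP Pl Pm (ex_intro2 _ _ y y0 dPy)
    (g := fun z => \det (Q (q * z)) - \det C / \det B * z ^- 2 * \det (Q z))).
    move=> z z0; have qz0 : q * z != 0 by rewrite mulf_neq0.
    apply: dcontB.
      apply: (@dcont_comp _ _ _ (fun z => q * z) (fun z => \det (Q z))).
        by apply: dcontM; [exact: dcont_cst|exact: dcont_id].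
      exact/cdiff_cont/Qd.
    apply: dcontM; last exact/cdiff_cont/Qd.
    apply: dcontM; first exact: dcont_cst.
    by apply: dcontV; [rewrite expf_neq0|apply: dcontX; exact: dcont_id].
  move=> z z0 dPz; have qz0 : q * z != 0 by rewrite mulf_neq0.
  have := Mq z z0; rewrite MPQ // MPQ // => /(congr1 determinant).
  rewrite !det_mulmx Pm // det_inv_scale ?expf_neq0 // => h.
  apply: (mulfI (_ : \det A / \det C * z ^- 2 * \det (P z) != 0)).
    by rewrite !mulf_neq0 // ?invr_eq0 // expf_neq0.
  by rewrite mulr0 mulrBr h; field; rewrite z0 dC dB.
(* The last two points are inequivalent to [x 0] and [x 1], so det P is nonzero there and the zero
   of det M comes from det Q. *)
have Qx (k : 'I_4) : (1 < k)%N -> \det (Q (x k)) = 0.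
  move=> k1; have := Mx k; rewrite MPQ // det_mulmx => /eqP; rewrite mulf_eq0.
  move=> /orP[/eqP/Pz|/eqP //]; case=> // /q_equiv_sym h; exfalso.
    by apply: (xNR _ h); exact: ltn_trans k1.
  exact: (xNR _ h).
have cQ : \det C / \det B != 0 by rewrite mulf_neq0 ?invr_eq0.
have Qz := zeros _ _ (x i2) (x i3) cQ Ql Qm dQy (x0 _) (x0 _) (@xNR i2 i3 isT) (Qx i2 isT) (Qx i3 isT).
by split=> //; exists y.
Qed.

(* The zeros of det P' and det Q are disjoint, so P'^-1 P = Q' Q^-1 extends to C^*. *)
Lemma mano_factor_gauge (C C' : 'M[R[i]]_2) : mano_factor q A x M C -> mano_factor q A x M C' ->
  exists L : R[i] -> 'M[R[i]]_2, [/\ forall z, z != 0 -> cdiff_mx L z,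
    forall z, z != 0 -> L (q * z) *m C = C' *m L z &
    exists2 z, z != 0 & \det (L z) != 0].
Proof.
move=> [P [Q hPQ]] [P' [Q' hPQ']].
have [dC _ _ _ Qz] := mano_det_zeros hPQ.
have [dC' Pm' Pn' Pz' _] := mano_det_zeros hPQ'.
have [[/holomorphic_mxE Ph /holomorphic_mxE Qh] Cu MPQ Pq _] := hPQ.
have [[/holomorphic_mxE Ph' /holomorphic_mxE Qh'] Cu' MPQ' Pq' _] := hPQ'.
have [_ _ [y y0 My] _] := MF.
have unit_det (X : 'M[R[i]]_2) : \det X != 0 -> X \in unitmx by rewrite unitmxE unitfE.
have disj z : z != 0 -> \det (P' z) = 0 -> \det (Q z) != 0.
  move=> z0 /(Pz' z z0) h1; apply/eqP => /(Qz z z0) h2.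
  have nx (k l : 'I_4) : (k < l)%N -> q_equiv q z (x k) -> q_equiv q z (x l) -> False.
    by move=> kl /q_equiv_sym hk hl; apply: (xNR kl); exact: (q_equiv_trans q0 z0 hk hl).
  by case: h1 => h1; case: h2 => h2; apply: (nx _ _ _ h1 h2).
(* Where both inverses exist, the two branches agree because P Q = P' Q' = M. So each formula
   describes [L] on a whole neighbourhood of a point where its own determinant is nonzero. *)
pose L z := if \det (P' z) != 0 then invmx (P' z) *m P z else Q' z *m invmx (Q z).
have LQ z : z != 0 -> \det (Q z) != 0 -> L z = Q' z *m invmx (Q z).
  move=> z0 /unit_det Qu; rewrite /L; case: ifP => // /unit_det Pu.
  have := MPQ z z0; rewrite MPQ' // => h.
  by rewrite -[P z](mulmxK Qu) -h -mulmxA mulKmx.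
have Lh z : z != 0 -> cdiff_mx L z.
  move=> z0; have [/eqP dz|dz] := boolP (\det (P' z) == 0).
    have dQ := disj z z0 dz.
    have [r r0 hr] := dcont_neq0 (cdiff_cont (cdiff_det (Qh z z0))) dQ.
    have [s s0 hs] := dcont_neq0 (@dcont_id R z) z0.
    apply: (@cdiff_near_mx _ (fun w => Q' w *m invmx (Q w)) _ _ (Num.min r s)).
    - by rewrite lt_min r0.
    - by move=> w; rewrite lt_min => /andP[/hr h1 /hs h2]; rewrite LQ.
    by apply: cdiff_mulmx; [exact: Qh'|apply: cdiff_invmx => //; exact: Qh].
  have [r r0 hr] := dcont_neq0 (cdiff_cont (cdiff_det (Ph' z z0))) dz.
  apply: (@cdiff_near_mx _ (fun w => invmx (P' w) *m P w) _ _ r) => //.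
    by move=> w /hr; rewrite /L => ->.
  by apply: cdiff_mulmx; [apply: cdiff_invmx => //; exact: Ph'|exact: Ph].
have Lq z : z != 0 -> \det (P' z) != 0 -> L (q * z) *m C = C' *m L z.
  move=> z0 dz; have dqz : \det (P' (q * z)) != 0.
    by rewrite Pm' // !mulf_neq0 ?invr_eq0 ?expf_neq0.
  rewrite /L dz dqz (Pq z z0); have Pu := unit_det _ dz.
  apply: (intertwine_quotient (P z) Pu Cu Cu' z0 (unit_det _ dqz) (Pq' z z0)).
exists L; split=> //.
  move=> z z0; apply/matrixP => i j; apply/eqP; rewrite -subr_eq0; apply/eqP.
  have cA : \det A / \det C' != 0 by rewrite mulf_neq0 ?invr_eq0.
  have Pl : laurent (fun z => \det (P' z)).
    by apply: holo_laurent => w w0; exact/cdiff_det/Ph'.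
  move: z z0; apply: (theta2_dense q0 q1 cA Pl Pm' Pn'
    (g := fun z => (L (q * z) *m C) i j - (C' *m L z) i j)).
    move=> z z0; have qz0 : q * z != 0 by rewrite mulf_neq0.
    apply: dcontB; apply: cdiff_cont.
      apply: (@cdiff_comp _ (fun z => q * z) (fun z => (L z *m C) i j)).
        by apply: cdiffM; [exact: cdiff_cst|exact: cdiff_id].
      by apply: cdiff_mulmx; [exact: Lh|exact: cdiff_cstmx].
    by apply: cdiff_mulmx; [exact: cdiff_cstmx|exact: Lh].
  by move=> z z0 dz; rewrite Lq // subrr.
exists y => //.
have := My; rewrite MPQ // det_mulmx mulf_eq0 => /norP[dP _].
have := My; rewrite MPQ' // det_mulmx mulf_eq0 => /norP[dP' _].
by rewrite /L dP' det_mulmx det_inv mulf_neq0 ?invr_eq0.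
Qed.

Lemma mano_factor_transfer (C C' : 'M[R[i]]_2) (L L' : R[i] -> 'M[R[i]]_2) :
  (forall z, z != 0 -> cdiff_mx L z) -> (forall z, z != 0 -> cdiff_mx L' z) ->
  (forall z, z != 0 -> L z *m L' z = 1%:M) -> C' \in unitmx ->
  (forall z, z != 0 -> L (q * z) *m C = C' *m L z) ->
  mano_factor q A x M C -> mano_factor q A x M C'.
Proof.
move=> Lh Lh' LL Cu' LC [P [Q [[/holomorphic_mxE Ph /holomorphic_mxE Qh] Cu MPQ Pq [P0 P1]]]].
exists (fun z => P z *m L' z), (fun z => L z *m Q z); split=> //.
- by split; apply/holomorphic_mxE => z z0; apply: cdiff_mulmx; auto.
- by move=> z z0; rewrite mulmxA -[P z *m _ *m _]mulmxA (mulmx1C (LL z z0)) mulmx1 MPQ.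
- move=> z z0; have qz0 : q * z != 0 by rewrite mulf_neq0.
  by rewrite Pq //; apply: (intertwine_inverse _ _ Cu Cu' z0 (LL z z0) (LL _ qz0) (LC z z0)).
- by rewrite !det_mulmx P0 P1 !mul0r.
Qed.

Lemma mano_factor_conj (C g : 'M[R[i]]_2) : g \in unitmx -> mano_factor q A x M C ->
  mano_factor q A x M (g *m C *m invmx g).
Proof.
move=> gu hC; have Cu : C \in unitmx by case: hC => P [Q []].
apply: (@mano_factor_transfer C _ (fun=> g) (fun=> invmx g)) => //.
- by move=> z _; exact: cdiff_cstmx.
- by move=> z _; exact: cdiff_cstmx.
- by move=> z _; rewrite mulmxV.
- by rewrite !unitmx_mul gu Cu unitmx_inv gu.
- by move=> z _; rewrite mulmxKV.
Qed.

(** The gauge is Diag(z^m, z^n). It would multiply the off-diagonal entry by a power z^(m-n), so the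
    new factor is constant only if that entry vanishes or m = n. *)
Lemma mano_factor_diag a b u (m n : int) : (u = 0) \/ m = n ->
  mano_factor q A x M (mx2 a u 0 b) ->
  mano_factor q A x M (mx2 (q ^ m * a) (q ^ m * u) 0 (q ^ n * b)).
Proof.
move=> umn hC; have Cu : mx2 a u 0 b \in unitmx by case: hC => P [Q []].
have pw c (k : int) : forall z, z != 0 -> cdiff (fun w : R[i] => c * w ^ k) z.
  by move=> z z0; apply: cdiffM; [exact: cdiff_cst|exact: cdiffXz].
have dg (k l : int) z : z != 0 -> cdiff_mx (fun z : R[i] => mx2 (z ^ k) 0 0 (z ^ l)) z.
  move=> z0 i j; apply: (@cdiff_eq _ (fun z : R[i] => if i == 0 then (if j == 0 then z ^ k else 0)
    else (if j == 0 then 0 else z ^ l))); first by move=> w; rewrite mxE.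
  by case: (i == 0); case: (j == 0);
    [exact: cdiffXz|exact: cdiff_cst|exact: cdiff_cst|exact: cdiffXz].
apply: (@mano_factor_transfer _ _ (fun z => mx2 (z ^ m) 0 0 (z ^ n))
  (fun z => mx2 (z ^ (- m)) 0 0 (z ^ (- n)))) hC.
- exact: dg.
- exact: dg.
- move=> z z0; rewrite mx2M !mulr0 !mul0r !addr0 !add0r -!expfzDr // !subrr !expr0z.
  exact: mx2_1.
- move: Cu; rewrite !unitmxE !unitfE !det_mx2E !mulr0 !subr0 !mulf_eq0 !negb_or.
  by rewrite !expfz_neq0 // => /andP[-> ->].
- move=> z z0; rewrite !mx2M !mulr0 !mul0r !addr0 !add0r !expfzMl.
  have -> : q ^ m * z ^ m * u = q ^ m * u * z ^ n.
    by case: umn => ->; [rewrite !mulr0 mul0r|rewrite mulrAC].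
  by congr mx2; rewrite mulrAC.
Qed.

End Gauge.

Lemma annulus_scale (c : R[i]) : c != 0 -> exists n : int, in_annulus q (q ^ n * c).
Proof.
move=> c0; have qc0 : 0 < cabs q by rewrite cabs_gt0.
have qc01 : 0 <= cabs q < 1 by rewrite ltW.
have cc0 : 0 < cabs c by rewrite cabs_gt0.
have [N hN] := geom_lt (cabs c) qc01 ltr01; have {hN} := hN N (leqnn N) => hN.
pose c' := q ^+ N * c; have c'0 : 0 < cabs c' by rewrite cabs_gt0 mulf_neq0 // expf_neq0.
(* With the modulus below 1, the exponent 0 fails in the minimisation, so the minimal exponent has a
   predecessor. *)
have c'1 : cabs c' < 1 by rewrite cabsM cabsX mulrC.
have [K hK] := geom_lt 1 qc01 c'0.
have exm : exists m, cabs q ^+ m < cabs c'.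
  by exists K; have := hK K (leqnn K); rewrite mul1r.
case: (ex_minnP exm) => -[|m] hm minm.
  by move: hm; rewrite expr0 => /(lt_trans c'1); rewrite ltxx.
(* Here [m.+1] is the minimal exponent, so |q|^(m+1) < |c'| <= |q|^m; dividing by q^m lands in the
   annulus. *)
exists (Posz N - Posz m); rewrite expfzDr // -mulrA (mulrC _ c) mulrA -/c'.
rewrite /in_annulus ltr_cabs -(normr1 R[i]) ler_cabs cabs1 cabsM cabsXz -exprnN.
rewrite ltr_pdivlMr ?exprn_gt0 // -exprS hm ler_pdivrMr ?exprn_gt0 // mul1r leNgt.
by apply/negP => /minm; rewrite ltnn.
Qed.

Lemma annulus_neq0 (z : R[i]) : in_annulus q z -> z != 0.
Proof.
move=> /andP[h _]; rewrite -cabs_gt0; move: h; rewrite ltr_cabs.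
exact/le_lt_trans/cabs_ge0.
Qed.

(** The ratio of two moduli in the annulus lies strictly between |q| and 1/|q|. *)
Lemma annulus_pow (z w : R[i]) (n : int) : in_annulus q z -> in_annulus q w ->
  z = q ^ n * w -> n = 0.
Proof.
rewrite /in_annulus -(normr1 R[i]) !ltr_cabs !ler_cabs cabs1.
move=> /andP[z1 z2] /andP[w1 w2] h; have qc0 : 0 < cabs q by rewrite cabs_gt0.
have {h} : cabs z = cabs q ^ n * cabs w by rewrite h cabsM cabsXz.
have le1 (k : nat) : cabs q ^+ k.+1 <= cabs q.
  by rewrite exprS ler_piMr ?cabs_ge0 // exprn_ile1 ?cabs_ge0 // ltW.
case: n => [[//|k]|k] h; exfalso.
  have : cabs z <= cabs q * 1.
    by rewrite h ler_pM ?cabs_ge0 ?exprn_ge0 ?cabs_ge0 //; exact: le1.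
  by rewrite mulr1 leNgt z1.
have : cabs w = cabs q ^+ k.+1 * cabs z.
  by rewrite h NegzE -exprnN mulrA divff ?mul1r // expf_neq0 // gt_eqF.
move=> h'; have : cabs w <= cabs q * 1.
  by rewrite h' ler_pM ?cabs_ge0 ?exprn_ge0 ?cabs_ge0 //; exact: le1.
by rewrite mulr1 leNgt w1.
Qed.

End ManoFactors.

(** * Normal forms *)

Section NormalForms.
Variables (R : realType) (q : R[i]).
Hypotheses (q0 : q != 0) (q1 : cabs q < 1).
Implicit Types (c d e k u v : R[i]) (C : 'M[R[i]]_2).

(** The term [e] affects only the coefficient of index 0. It is there so that a triangular system
    can be solved one entry at a time. *)
Lemma affine_qshift_cst (f : R[i] -> R[i]) c d e : (forall z, z != 0 -> cdiff f z) ->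
  in_annulus q c -> in_annulus q d -> (forall z, z != 0 -> f (q * z) * c = d * f z + e) ->
  exists k, forall z, z != 0 -> f z = k.
Proof.
move=> fd ca da fq; have [fc fl] := holo_laurent fd.
have u1 : (1 : R[i]) != 0 := oner_neq0 _.
have cstE k n z : z != 0 -> laurent_coef (fun=> k) n z = k * (n == 0)%:R.
  move=> z0; rewrite -(circle_mean_pow n z0) -cintZ; last first.
    exact: (rcont_circle z0 (@cont_pow R n)).
  by apply: cint_eq => t; rewrite mulrC.
have cc k : cont_Cstar (fun=> k) by move=> z _; exact: dcont_cst.
have a0 n : n != 0 -> laurent_coef f n 1 = 0.
  move=> n0; set a := laurent_coef f n 1.
  have df : cont_Cstar (fun z => d * f z) by move=> z z0; apply: dcontM; [exact: dcont_cst|exact: fc].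
  have : c * a = q ^ n * d * a.
    have -> : q ^ n * d * a = q ^ n * laurent_coef (fun w => d * f w + e) n 1.
      by rewrite laurent_coefD // laurent_coefZ // cstE // (negPf n0) mulr0 addr0 mulrA.
    rewrite /a (fl n 1 q) // -!cintZ; last 2 first.
    - apply: (rcont_circle u1 (f := fun w => w ^ n * (d * f w + e))); apply: cont_coef => z z0.
      by apply: dcontD; [exact: df|exact: dcont_cst].
    - by apply: (rcont_circle q0 (f := fun w => w ^ n * f w)); exact: cont_coef.
    apply: cint_eq => t; rewrite /= mul1r -fq ?cexp_neq0 // (expfzMl q).
    by rewrite (mulrC c) -!mulrA.
  move=> /eqP; rewrite -subr_eq0 -mulrBl mulf_eq0 => /orP[|/eqP //].
  rewrite subr_eq0 => /eqP/(annulus_pow q0 q1 ca da) n0'.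
  by rewrite n0' eqxx in n0.
exists (laurent_coef f 0 1) => z z0; set k := laurent_coef f 0 1.
apply/eqP; rewrite -subr_eq0; apply/eqP.
apply: (laurent_coef_inj z0 (f := fun w => f w + - k)).
  by move=> w w0; apply: dcontD; [exact: fc|exact: dcont_cst].
move=> n; rewrite laurent_coefD // cstE // (fl n z 1) //.
by have [->|/a0 ->] := eqVneq n 0; rewrite ?mulr1 ?subrr // mulr0 addr0.
Qed.

(** Triangularity orders the entries: the lower left one satisfies a scalar equation, the diagonal
    ones an equation with a constant term coming from it, and the upper right one an equation with a
    constant term coming from the diagonal. *)
Lemma gauge_cst (L : R[i] -> 'M[R[i]]_2) c1 u c2 d1 v d2 :
  (forall z, z != 0 -> cdiff_mx L z) ->
  (forall z, z != 0 -> L (q * z) *m mx2 c1 u 0 c2 = mx2 d1 v 0 d2 *m L z) ->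
  in_annulus q c1 -> in_annulus q c2 -> in_annulus q d1 -> in_annulus q d2 ->
  exists L0, forall z, z != 0 -> L z = L0.
Proof.
move=> Ld LC c1a c2a d1a d2a.
have ent i j z : z != 0 -> (L (q * z) *m mx2 c1 u 0 c2) i j = (mx2 d1 v 0 d2 *m L z) i j.
  by move=> z0; rewrite LC.
have LE z : L z = mx2 (L z 0 0) (L z 0 1) (L z 1 0) (L z 1 1) by exact: mx2_eta.
have E z : z != 0 -> [/\ L (q * z) 0 0 * c1 = d1 * L z 0 0 + v * L z 1 0,
    L (q * z) 0 0 * u + L (q * z) 0 1 * c2 = d1 * L z 0 1 + v * L z 1 1,
    L (q * z) 1 0 * c1 = d2 * L z 1 0 &
    L (q * z) 1 0 * u + L (q * z) 1 1 * c2 = d2 * L z 1 1].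
  move=> z0; have := LC z z0; rewrite (LE z) (LE (q * z)) !mx2M => /mx2_inj.
  by rewrite !mulr0 !addr0 !mul0r !add0r -(LE z) -(LE (q * z)).
have [k10 h10] : exists k, forall z, z != 0 -> L z 1 0 = k.
  apply: (@affine_qshift_cst (fun z => L z 1 0) c1 d2 0) => // z z0; first exact: Ld.
  by have [_ _ -> _] := E z z0; rewrite addr0.
have hq z : z != 0 -> q * z != 0 by move=> z0; rewrite mulf_neq0.
have [k00 h00] : exists k, forall z, z != 0 -> L z 0 0 = k.
  apply: (@affine_qshift_cst (fun z => L z 0 0) c1 d1 (v * k10)) => // z z0; first exact: Ld.
  by have [-> _ _ _] := E z z0; rewrite h10.
have [k11 h11] : exists k, forall z, z != 0 -> L z 1 1 = k.
  apply: (@affine_qshift_cst (fun z => L z 1 1) c2 d2 (- (k10 * u))) => // z z0; first exact: Ld.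
  by have [_ _ _ <-] := E z z0; rewrite (h10 _ (hq z z0)) addrC addKr.
have [k01 h01] : exists k, forall z, z != 0 -> L z 0 1 = k.
  apply: (@affine_qshift_cst (fun z => L z 0 1) c2 d1 (v * k11 - k00 * u)) => // z z0; first exact: Ld.
  have [_ h _ _] := E z z0; move: h; rewrite (h00 _ (hq z z0)) (h11 z z0) => h.
  by rewrite addrA -h addrC addKr.
by exists (mx2 k00 k01 k10 k11) => z z0; rewrite (LE z) h00 ?h01 ?h10 ?h11.
Qed.

Lemma normal_form_triangular t C : normal_form q t C -> exists c1 u c2,
  [/\ C = mx2 c1 u 0 c2, in_annulus q c1 & in_annulus q c2].
Proof.
case: t => [[x [xa ->]]|[x [y [xa ya _ ->]]]|[x [xa ->]]].
- by exists x, 0, x.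
- by exists x, 0, y.
- by exists x, x, x.
Qed.

Lemma normal_form_similar t t' C C' L : L \in unitmx -> L *m C = C' *m L ->
  normal_form q t C -> normal_form q t' C' ->
  t = t' /\ (C' = C \/ (t = Generic /\
    exists xi1 xi2, C = mx2 xi1 0 0 xi2 /\ C' = mx2 xi2 0 0 xi1)).
Proof.
move=> Lu LC nC nC'.
have C'E : C' = L *m C *m invmx L by rewrite LC mulmxK.
have CE : C = invmx L *m C' *m L by rewrite -mulmxA -LC mulKmx.
have two0 : (2%:R : R[i]) != 0 by rewrite pnatr_eq0.
have trC : \tr C' = \tr C by rewrite C'E mxtrace_mulC mulKmx.
have detC : \det C' = \det C.
  have : \det L * \det C = \det C' * \det L by rewrite -!det_mulmx LC.
  rewrite mulrC => /mulIf -> //; by rewrite -unitfE -unitmxE.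
have tr2 a b c d : \tr (mx2 a b c d : 'M[R[i]]_2) = a + d.
  rewrite /mxtrace !big_ord_recl big_ord0 addr0 !mxE //.
have scal k : (mx2 k 0 0 k : 'M[R[i]]_2) = k%:M.
  by apply/matrixP => i j; rewrite !mxE; case: i j => -[|[|i]] hi // [[|[|j]] hj].
have sc1 k : C = mx2 k 0 0 k -> C' = C.
  by move=> Ck; rewrite C'E Ck scal scalar_mxC mulmxK.
have sc2 k : C' = mx2 k 0 0 k -> C' = C.
  by move=> Ck; rewrite CE Ck scal scalar_mxC mulmxKV.
(* Similar matrices share the discriminant tr^2 - 4 det, which is (x - y)^2 on one side and 0 on the
   other. *)
have gl k x y : C = mx2 x 0 0 y -> C' = mx2 k k 0 k -> x = y.
  move=> E E'; move: trC detC; rewrite E E' !tr2 !det_mx2E !mul0r !mulr0 !subr0 => h1 h2.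
  apply/eqP; rewrite -subr_eq0 -sqrf_eq0; apply/eqP.
  have -> : (x - y) ^+ 2 = (x + y) ^+ 2 - 4 * (x * y) by ring.
  by rewrite -h1 -h2; ring.
have lg k x y : C' = mx2 x 0 0 y -> C = mx2 k k 0 k -> x = y.
  move=> E E'; move: trC detC; rewrite E E' !tr2 !det_mx2E !mul0r !mulr0 !subr0 => h1 h2.
  apply/eqP; rewrite -subr_eq0 -sqrf_eq0; apply/eqP.
  have -> : (x - y) ^+ 2 = (x + y) ^+ 2 - 4 * (x * y) by ring.
  by rewrite h1 h2; ring.
case: t t' nC nC' => [] [] /=.
- by move=> [x [xa E]] _; split=> //; left; exact: (sc1 x).
- move=> [x [xa E]] [y [z [ya za yz E']]]; exfalso.
  have := sc1 x E; rewrite E E' => /mx2_inj[h1 _ _ h2].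
  by rewrite h1 h2 eqxx in yz.
- move=> [x [xa E]] [y [ya E']]; exfalso.
  have := sc1 x E; rewrite E E' => /mx2_inj[_ h _ _].
  by have := annulus_neq0 ya; rewrite h eqxx.
- move=> [y [z [ya za yz E']]] [x [xa E]]; exfalso.
  have := sc2 x E; rewrite E E' => /mx2_inj[h1 _ _ h2].
  by rewrite -h1 -h2 eqxx in yz.
- move=> [x [y [xa ya xy E]]] [x' [y' [xa' ya' xy' E']]]; split=> //.
  move: trC detC; rewrite E E' !tr2 !det_mx2E !mul0r !subr0 => h1 h2.
  (* Equal trace and determinant make [x'] a root of the characteristic polynomial of [C]; the trace
     then gives the other eigenvalue. *)
  have : (x' - x) * (x' - y) = 0.
    have -> : (x' - x) * (x' - y) = x' ^+ 2 - x' * (x + y) + x * y by ring.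
    by rewrite -h1 -h2; ring.
  move=> /eqP; rewrite mulf_eq0 !subr_eq0 => /orP[] /eqP hx.
    by left; move: h1; rewrite hx => /addrI ->.
  right; split=> //; exists x, y; split=> //.
  by move: h1; rewrite hx (addrC x) => /addrI ->.
- move=> [x [y [xa ya xy E]]] [k [ka E']]; exfalso.
  by move: xy; rewrite (gl k x y E E') eqxx.
- move=> [y [ya E']] [x [xa E]]; exfalso.
  have := sc2 x E; rewrite E E' => /mx2_inj[_ h _ _].
  by have := annulus_neq0 ya; rewrite -h eqxx.
- move=> [k [ka E']] [x [y [xa ya xy E]]]; exfalso.
  by move: xy; rewrite (lg k x y E E') eqxx.
move=> [x [xa E]] [y [ya E']]; split=> //; left.
move: trC; rewrite E E' !tr2 => h; suff -> : x = y by [].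
by apply: (mulfI two0); rewrite !mulr_natl !mulr2n.
Qed.

Section Existence.
Variables (A : 'M[R[i]]_2) (x : 'I_4 -> R[i]) (M : R[i] -> 'M[R[i]]_2).

(** A row eigenvector placed as the second row of [g] turns the second row of g C g^-1 into (0,
    b). *)
Lemma mano_factor_triangular C : mano_factor q A x M C ->
  exists a u b, [/\ a != 0, b != 0 & mano_factor q A x M (mx2 a u 0 b)].
Proof.
move=> hC; have Cu : C \in unitmx by case: hC => P [Q []].
have [b] : exists b, root (char_poly C) b.
  by apply/closed_rootP; rewrite size_char_poly.
rewrite -eigenvalue_root_char => /eigenvalueP[v vC v0].
have [g gu gv] : exists2 g : 'M[R[i]]_2, g \in unitmx & row 1 g = v.
  have vE : v = \row_j (if j == 0 then v 0 0 else v 0 1).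
    apply/rowP => j; rewrite mxE; case: j => -[|[|j]] hj //=; congr (v _ _); exact/val_inj.
  have rE a c : row 1 (mx2 a c (v 0 0) (v 0 1)) = v.
    by rewrite [RHS]vE; apply/rowP => j; rewrite !mxE.
  have [v1|v1] := eqVneq (v 0 1) 0.
    exists (mx2 0 1 (v 0 0) (v 0 1)); last exact: rE.
    rewrite unitmxE unitfE det_mx2E mul0r mul1r sub0r oppr_eq0.
    apply: contraNneq v0 => v00; rewrite vE v1 v00; apply/eqP/rowP => j.
    by rewrite !mxE if_same.
  exists (mx2 1 0 (v 0 0) (v 0 1)); last exact: rE.
  by rewrite unitmxE unitfE det_mx2E mul0r mul1r subr0.
set T := g *m C *m invmx g.
have T10 : T 1 0 = 0.
  have : row 1 T = b *: delta_mx 0 1.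
    rewrite !row_mul gv vC -scalemxAl -gv -row_mul mulmxV //; congr (_ *: _).
    by rewrite rowE mulmx1.
  by move/rowP/(_ 0); rewrite !mxE /= mulr0.
have hT : mano_factor q A x M T by exact: mano_factor_conj.
have Tu : T \in unitmx by case: hT => P [Q []].
rewrite (mx2_eta T) T10 in hT Tu; exists (T 0 0), (T 0 1), (T 1 1).
by move: Tu; rewrite unitmxE unitfE det_mx2E mulr0 subr0 mulf_eq0 => /norP[-> ->].
Qed.

Lemma mano_factor_diag_normal a b : a != 0 -> b != 0 -> mano_factor q A x M (mx2 a 0 0 b) ->
  exists t C, mano_factor q A x M C /\ normal_form q t C.
Proof.
move=> a0 b0 h; have [m ma] := annulus_scale q0 q1 a0; have [n nb] := annulus_scale q0 q1 b0.
have := mano_factor_diag q0 (m := m) (n := n) (or_introl erefl) h; rewrite mulr0 => h'.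
have [e|e] := eqVneq (q ^ m * a) (q ^ n * b).
  by exists Trivial, (mx2 (q ^ m * a) 0 0 (q ^ n * b)); split=> //; exists (q ^ m * a); rewrite -e.
exists Generic, (mx2 (q ^ m * a) 0 0 (q ^ n * b)); split=> //.
by exists (q ^ m * a), (q ^ n * b).
Qed.

Lemma mano_factor_conjE C C' g : g \in unitmx -> g *m C = C' *m g ->
  mano_factor q A x M C -> mano_factor q A x M C'.
Proof.
by move=> gu gC /(mano_factor_conj q0 gu); rewrite gC mulmxK.
Qed.

Lemma mano_factor_normal C : mano_factor q A x M C ->
  exists t C, mano_factor q A x M C /\ normal_form q t C.
Proof.
move=> /mano_factor_triangular[a [u [b [a0 b0 h]]]].
have [ab|ab] := eqVneq a b; last first.
  apply: (mano_factor_diag_normal a0 b0).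
  have d0 : a - b != 0 by rewrite subr_eq0.
  (* For a unipotent [g] with corner t, diagonalisation asks for u + t b = a t. *)
  apply: (mano_factor_conjE (g := mx2 1 (u / (a - b)) 0 1)) h.
    by rewrite unitmxE unitfE det_mx2E mulr0 subr0 mulr1 oner_neq0.
  by rewrite !mx2M; congr mx2; field.
have [u0|u0] := eqVneq u 0.
  by rewrite u0 in h; exact: (mano_factor_diag_normal a0 b0 h).
rewrite -ab in h; have [n na] := annulus_scale q0 q1 a0.
have h' : mano_factor q A x M (mx2 a a 0 a).
  (* Conjugation rescales the corner from u to a, the eigenvalue, and the later common factor
     [q ^ n] preserves this equality. *)
  apply: (mano_factor_conjE (g := mx2 (a / u) 0 0 1)) h.
    by rewrite unitmxE unitfE det_mx2E mulr0 subr0 mulr1 mulf_neq0 // invr_eq0.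
  by rewrite !mx2M; congr mx2; field.
exists Logarithmic, (mx2 (q ^ n * a) (q ^ n * a) 0 (q ^ n * a)); split.
  exact: (mano_factor_diag q0 (or_intror erefl) h').
by exists (q ^ n * a).
Qed.

Lemma mano_factor_swap a b : mano_factor q A x M (mx2 a 0 0 b) ->
  mano_factor q A x M (mx2 b 0 0 a).
Proof.
apply: (mano_factor_conjE (g := mx2 0 1 1 0)).
  by rewrite unitmxE unitfE det_mx2E mul0r mul1r sub0r oppr_eq0 oner_neq0.
by rewrite !mx2M; congr mx2; ring.
Qed.

End Existence.
End NormalForms.

Theorem proposition5p10 (R : realType) (q : R[i])
    (hq : 0 < `|q| < 1)
    (rho sigma : 'I_2 -> R[i]) (x : 'I_4 -> R[i])
    (hrho : forall i, rho i != 0) (hsigma : forall i, sigma i != 0)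
    (hx : forall k, x k != 0)
    (hFR : cond_FR q rho sigma x)
    (hNR : cond_NR q rho sigma x)
    (hNS : cond_NS q rho sigma x)
    (M : R[i] -> 'M[R[i]]_2)
    (hM : in_F q (diag_fun rho) (diag_fun sigma) x M)
    (hdec : exists C, mano_factor q (diag_fun rho) x M C) :
  [/\ exists! t : factor_type, exists C,
        mano_factor q (diag_fun rho) x M C /\ normal_form q t C,
      forall (t : factor_type) (C C' : 'M[R[i]]_2),
        mano_factor q (diag_fun rho) x M C -> normal_form q t C ->
        mano_factor q (diag_fun rho) x M C' -> normal_form q t C' ->
        C' = C \/
        (t = Generic /\
         exists xi1 xi2, C = mx2 xi1 0 0 xi2 /\ C' = mx2 xi2 0 0 xi1) &
      forall xi1 xi2 : R[i],
        normal_form q Generic (mx2 xi1 0 0 xi2) ->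
        mano_factor q (diag_fun rho) x M (mx2 xi1 0 0 xi2) ->
        mano_factor q (diag_fun rho) x M (mx2 xi2 0 0 xi1)].
Proof.
have q0 : q != 0 by rewrite -normr_gt0; case/andP: hq.
have q1 : cabs q < 1.
  by case/andP: hq => _; rewrite -(normr1 R[i]) ltr_cabs cabs1.
have diag_unit (d : 'I_2 -> R[i]) : (forall i, d i != 0) -> diag_fun d \in unitmx.
  move=> d0; rewrite unitmxE unitfE det_diag; apply/prodf_neq0 => i _.
  by rewrite mxE.
have [_ _ xNR] := hNR.
(* The types are kept distinct so that uniqueness of the type and uniqueness of the form both follow
   from this one comparison. *)
have similar t t' C C' : mano_factor q (diag_fun rho) x M C -> normal_form q t C ->
    mano_factor q (diag_fun rho) x M C' -> normal_form q t' C' ->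
    t = t' /\ (C' = C \/ (t = Generic /\
      exists xi1 xi2, C = mx2 xi1 0 0 xi2 /\ C' = mx2 xi2 0 0 xi1)).
  move=> hC nC hC' nC'.
  have [L [Ld LC [z z0 Lz]]] := mano_factor_gauge q0 q1 (diag_unit _ hrho) (diag_unit _ hsigma)
    hx xNR hM hC hC'.
  have [c1 [u [c2 [CE c1a c2a]]]] := normal_form_triangular nC.
  have [d1 [v [d2 [CE' d1a d2a]]]] := normal_form_triangular nC'.
  have LC' : forall z, z != 0 -> L (q * z) *m mx2 c1 u 0 c2 = mx2 d1 v 0 d2 *m L z.
    by rewrite -CE -CE'.
  have [L0 hL0] := gauge_cst q0 q1 Ld LC' c1a c2a d1a d2a.
  apply: (normal_form_similar (L := L0) _ _ nC nC').
    by rewrite unitmxE unitfE -(hL0 z z0).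
  by have := LC z z0; rewrite !hL0 // mulf_neq0.
split.
- have [C0 hC0] := hdec; have [t [C [hC nC]]] := mano_factor_normal q0 q1 hC0.
  exists t; split; first by exists C.
  by move=> t' [C' [hC' nC']]; have [] := similar _ _ _ _ hC nC hC' nC'.
- by move=> t C C' hC nC hC' nC'; have [] := similar _ _ _ _ hC nC hC' nC'.
- by move=> xi1 xi2 _; exact: mano_factor_swap.
Qed.
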